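(* Let $G$ be a simply connected Lie group and let $V$ be a finite dimensional complex vector space. Let $\rho:G\to \mathrm{PGL}(V)$ be a homomorphism (of Lie groups). Then $\rho$ lifts to a homomorphism $\tilde{\rho}:G\to\mathrm{GL}(V)$. If $G$ is semisimple, this lift is unique.
   Context: $\mathrm{PGL}(V)=\mathrm{GL}(V)/\mathbb C^*$. A lift is a Lie group homomorphism $\tilde\rho$ whose composition with the quotient map $\mathrm{GL}(V)\to\mathrm{PGL}(V)$ is $\rho$. *)

(* Defs.v *)
From HB Require Import structures.
From mathcomp Require Import all_boot all_order all_algebra generic_quotient.
From mathcomp Require Import all_classical all_reals all_analysis.
From mathcomp Require Import complex.

Set Implicit Arguments.
Unset Strict Implicit.
Unset Printing Implicit Defensive.

Import Order.TTheory GRing.Theory Num.Theory.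
Import numFieldNormedType.Exports.

Local Open Scope classical_set_scope.
Local Open Scope ring_scope.

(* Meant for open U and finite-dimensional E: f is C^(k+1) on U iff it is
   differentiable on U and all its directional derivatives are C^k on U. *)
Fixpoint Ck_on (R : realType) (E F : normedModType R) (k : nat) (U : set E)
    (f : E -> F) : Prop :=
  if k is k'.+1 then
    (forall x, U x -> differentiable f x) /\
    (forall v : E, Ck_on k' U (fun x => 'D_v f x))
  else forall x, U x -> {for x, continuous f}.

Definition smooth_on (R : realType) (E F : normedModType R) (U : set E)
    (f : E -> F) : Prop :=
  forall k, Ck_on k U f.

(* The total functions [chart_map] and [chart_inv] are only meaningful on
   [chart_dom] and on its image respectively. *)
Record chart (T E : Type) := Chart {
  chart_dom : set T;
  chart_map :> T -> E;
  chart_inv : E -> T }.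

Section Manifolds.
Variable R : realType.

Definition is_chart (T : topologicalType) (E : normedModType R)
    (c : chart T E) : Prop :=
  [/\ open (chart_dom c), open (c @` chart_dom c),
      (forall x, chart_dom c x -> chart_inv c (c x) = x),
      {within chart_dom c, continuous c} &
      {within c @` chart_dom c, continuous (chart_inv c)}].

Definition smooth_atlas (T : topologicalType) (E : normedModType R)
    (A : set (chart T E)) : Prop :=
  [/\ (forall c, A c -> is_chart c),
      (forall x, exists2 c, A c & chart_dom c x) &
      (forall c c', A c -> A c' ->
         smooth_on (c @` (chart_dom c `&` chart_dom c')) (c' \o chart_inv c))].

(* A smooth structure is handled through its sheaf of smooth real functions:
   [F U] is the set of functions that are smooth on the open set U, the values
   outside U being irrelevant. *)
Definition atlas_sheaf (T : topologicalType) (E : normedModType R)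
    (A : set (chart T E)) : set T -> set (T -> R^o) :=
  fun U => [set f : T -> R^o | forall c, A c ->
    smooth_on (c @` (chart_dom c `&` U)) (f \o chart_inv c)].

Definition smooth_map (S T : topologicalType) (FS : set S -> set (S -> R^o))
    (FT : set T -> set (T -> R^o)) (h : S -> T) : Prop :=
  continuous h /\
  forall U f, open U -> FT U f -> FS (h @^-1` U) (f \o h).

Definition prod_chart (S T E F : Type) (c : chart S E) (d : chart T F) :
    chart (S * T) (E * F) :=
  Chart (chart_dom c `*` chart_dom d)
        (fun p => (c p.1, d p.2))
        (fun q => (chart_inv c q.1, chart_inv d q.2)).

Definition prod_atlas (S T E F : Type) (A : set (chart S E))
    (B : set (chart T F)) : set (chart (S * T) (E * F)) :=
  [set e | exists c d, [/\ A c, B d & e = prod_chart c d]].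

End Manifolds.

#[short(type="groupTopType")]
HB.structure Definition GroupTop := {G of Group G & Topological G}.

(* Real Lie groups, with the usual Hausdorff and second countable conventions. *)
Record lieGroup (R : realType) := LieGroup {
  lie_sort :> groupTopType;
  lie_dim : nat;
  lie_atlas : set (chart lie_sort 'rV[R]_lie_dim);
  lie_hausdorff : hausdorff_space lie_sort;
  lie_second_countable : @second_countable lie_sort;
  lie_atlasP : smooth_atlas lie_atlas;
  lie_mulP : smooth_map (atlas_sheaf (prod_atlas lie_atlas lie_atlas))
               (atlas_sheaf lie_atlas)
               (fun p : lie_sort * lie_sort => (p.1 * p.2)%g);
  lie_invP : smooth_map (atlas_sheaf lie_atlas) (atlas_sheaf lie_atlas)
               (fun x : lie_sort => (x^-1)%g) }.

Definition lie_sheaf (R : realType) (G : lieGroup R) :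
    set G -> set (G -> R^o) :=
  atlas_sheaf (@lie_atlas R G).

Definition lie_hom (R : realType) (G H : groupTopType)
    (FG : set G -> set (G -> R^o)) (FH : set H -> set (H -> R^o))
    (h : G -> H) : Prop :=
  {morph h : x y / (x * y)%g} /\ smooth_map FG FH h.

Definition simply_connected (R : realType) (T : topologicalType) : Prop :=
  [/\ (exists x : T, True),
      (forall x y : T, exists g : R -> T,
         [/\ {within `[0, 1], continuous g}, g 0 = x & g 1 = y]) &
      (forall g : R -> T, {within `[0, 1], continuous g} -> g 0 = g 1 ->
         exists H : R * R -> T,
           [/\ {within `[0, 1] `*` `[0, 1], continuous H},
               (forall t, t \in `[0, 1] -> H (0, t) = g t),
               (forall t, t \in `[0, 1] -> H (1, t) = g 0) &
               (forall s, s \in `[0, 1] ->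
                  H (s, 0) = g 0 /\ H (s, 1) = g 0)])].

(* Lie algebras given as subspaces L of an ambient vector space E carrying a
   bracket for which L is stable. *)
Section LieAlgebra.
Variables (K : fieldType) (E : lmodType K) (br : E -> E -> E).

Definition is_subspace (W : set E) : Prop :=
  W 0 /\ forall (a : K) x y, W x -> W y -> W (a *: x + y).

Definition lie_ideal (L I : set E) : Prop :=
  [/\ I `<=` L, is_subspace I & forall x y, L x -> I y -> I (br x y)].

Definition lie_simple (L : set E) : Prop :=
  (exists x y, [/\ L x, L y & br x y != 0]) /\
  forall I, lie_ideal L I -> I = [set 0] \/ I = L.

(* The empty sum is allowed: the zero Lie algebra is semisimple. *)
Definition lie_semisimple (L : set E) : Prop :=
  exists (m : nat) (S : 'I_m -> set E),
    [/\ (forall i, lie_ideal L (S i) /\ lie_simple (S i)),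
        (forall x, L x -> exists2 y : 'I_m -> E,
           (forall i, S i (y i)) & x = \sum_i y i) &
        (forall y : 'I_m -> E, (forall i, S i (y i)) ->
           \sum_i y i = 0 -> forall i, y i = 0)].

End LieAlgebra.

Section LieAlgebraOfGroup.
Variables (R : realType) (G : lieGroup R).

(* Left invariant vector fields, i.e. left invariant derivations of C^oo(G).
   A derivation is a total operator on functions G -> R; prescribing the value
   0 off C^oo(G) makes it determined by its action on C^oo(G). *)
Definition lie_algebra : set ((G -> R^o) -> (G -> R^o)) :=
  [set D | let Coo := @lie_sheaf R G setT in
    [/\ (forall f, Coo f -> Coo (D f)) /\ (forall f, ~ Coo f -> D f = 0),
        (forall (a : R) f g, Coo f -> Coo g ->
           D (a *: f + g) = a *: D f + D g),
        (forall f g, Coo f -> Coo g -> D (f \* g) = (D f \* g) + (f \* D g)) &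
        (forall (x : G) f, Coo f ->
           D (fun y => f (x * y)%g) = (fun y => D f (x * y)%g))]].

Definition op_bracket (D1 D2 : (G -> R^o) -> (G -> R^o)) :=
  (D1 \o D2) - (D2 \o D1).

Definition semisimple_group : Prop := lie_semisimple op_bracket lie_algebra.

End LieAlgebraOfGroup.

Section GL.
Variables (R : realType) (V : vectType R[i]).

Definition GL : Type := {f : 'End(V) | lker f == 0%VS}.

HB.instance Definition _ := SubType.on GL.
HB.instance Definition _ := Choice.on GL.

Fact gl_one_subproof : lker (\1%VF : 'End(V)) == 0%VS.
Proof. by apply/lker0P => x y; rewrite !lfunE. Qed.

Fact gl_mul_subproof (f g : GL) : lker (val f \o val g)%VF == 0%VS.
Proof.
apply/lker0P => x y; rewrite !comp_lfunE.
by move=> /(elimT lker0P (valP f)) /(elimT lker0P (valP g)).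
Qed.

Fact gl_inv_subproof (f : GL) : lker ((val f)^-1)%VF == 0%VS.
Proof.
apply/lker0P => x y e.
by rewrite -(lker0_lfunVK (valP f) x) e (lker0_lfunVK (valP f)).
Qed.

Definition gl_one : GL := exist _ \1%VF gl_one_subproof.
Definition gl_mul (f g : GL) : GL := exist _ (val f \o val g)%VF (gl_mul_subproof f g).
Definition gl_inv (f : GL) : GL := exist _ (val f)^-1%VF (gl_inv_subproof f).

Fact gl_mulA : associative gl_mul.
Proof. by move=> f g h; apply: val_inj; rewrite /= comp_lfunA. Qed.
Fact gl_mul1 : left_id gl_one gl_mul.
Proof. by move=> f; apply: val_inj; rewrite /= comp_lfun1l. Qed.
Fact gl_mulr1 : right_id gl_one gl_mul.
Proof. by move=> f; apply: val_inj; rewrite /= comp_lfun1r. Qed.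
Fact gl_mulV : left_inverse gl_one gl_inv gl_mul.
Proof. by move=> f; apply: val_inj => /=; apply: lker0_compVf (valP f). Qed.
Fact gl_mulrV : right_inverse gl_one gl_inv gl_mul.
Proof. by move=> f; apply: val_inj => /=; apply: lker0_compfV (valP f). Qed.

HB.instance Definition _ :=
  isGroup.Build GL gl_mulA gl_mul1 gl_mulr1 gl_mulV gl_mulrV.

(* GL(V) is an open subset of the complex vector space End(V); its topology and
   smooth structure come from the real and imaginary parts of the coordinates in
   a basis of End(V). *)
Definition gl_dim : nat := \dim {: 'End(V)}.

Definition gl_model : normedModType R := ('rV[R]_gl_dim * 'rV[R]_gl_dim)%type.

Definition gl_coord (f : GL) : gl_model :=
  (\row_j complex.Re (coord (vbasis {: 'End(V)}) j (val f)),
   \row_j complex.Im (coord (vbasis {: 'End(V)}) j (val f))).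

Definition gl_of_coord (z : gl_model) : GL :=
  insubd gl_one (\sum_(j < gl_dim)
    (z.1 ord0 j +i* z.2 ord0 j)%C *: (vbasis {: 'End(V)})`_j).

HB.instance Definition _ := Topological.copy GL (initial_topology gl_coord).

Definition gl_chart : chart GL gl_model := Chart setT gl_coord gl_of_coord.

Definition gl_sheaf : set GL -> set (GL -> R^o) := atlas_sheaf [set gl_chart].

End GL.

Section PGL.
Variables (R : realType) (V : vectType R[i]).

Definition scalar_rel (f g : GL V) : bool :=
  `[< exists2 a : R[i], a != 0 & val f = a *: val g >].

Fact scalar_rel_refl : reflexive scalar_rel.
Proof. by move=> f; apply/asboolP; exists 1; rewrite ?oner_eq0 ?scale1r. Qed.
Fact scalar_rel_sym : symmetric scalar_rel.
Proof.
suff s f g : scalar_rel f g -> scalar_rel g f by move=> f g; apply/idP/idP => /s.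
move=> /asboolP[a a0 e]; apply/asboolP; exists a^-1; rewrite ?invr_eq0//.
by rewrite e scalerA mulVf// scale1r.
Qed.
Fact scalar_rel_trans : transitive scalar_rel.
Proof.
move=> g f h /asboolP[a a0 e] /asboolP[b b0 e']; apply/asboolP.
by exists (a * b); rewrite ?mulf_neq0// e e' scalerA.
Qed.

Canonical scalar_equiv :=
  EquivRel scalar_rel scalar_rel_refl scalar_rel_sym scalar_rel_trans.

Local Open Scope quotient_scope.

Definition PGL : Type := quotient_topology {eq_quot scalar_equiv}.

HB.instance Definition _ := Choice.on PGL.
HB.instance Definition _ := Quotient.on PGL.
HB.instance Definition _ := Topological.on PGL.

Definition pgl_pi (f : GL V) : PGL := \pi_PGL f.

Definition pgl_one : PGL := pgl_pi 1%g.
Definition pgl_mul (x y : PGL) : PGL := pgl_pi (repr x * repr y)%g.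
Definition pgl_inv (x : PGL) : PGL := pgl_pi (repr x)^-1%g.

Fact pgl_piP (f g : GL V) :
  pgl_pi f = pgl_pi g <-> exists2 a : R[i], a != 0 & val f = a *: val g.
Proof.
split=> [/(@eqmodP _ scalar_equiv f g)|h]; first by move/asboolP.
by apply/(@eqmodP _ scalar_equiv f g); apply/asboolP.
Qed.

Fact pgl_reprK (x : PGL) : pgl_pi (repr x) = x.
Proof. exact: reprK. Qed.

Fact pgl_piM (f g : GL V) : pgl_pi (f * g)%g = pgl_mul (pgl_pi f) (pgl_pi g).
Proof.
apply/pgl_piP.
have [a a0 ea] := (pgl_piP _ _).1 (esym (pgl_reprK (pgl_pi f))).
have [b b0 eb] := (pgl_piP _ _).1 (esym (pgl_reprK (pgl_pi g))).
exists (a * b); first by rewrite mulf_neq0.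
by rewrite [LHS]/= ea eb -comp_lfunZl -comp_lfunZr scalerA.
Qed.

Fact pgl_mulA : associative pgl_mul.
Proof.
move=> x y z; rewrite -(pgl_reprK x) -(pgl_reprK y) -(pgl_reprK z).
by rewrite -!pgl_piM mulgA.
Qed.
Fact pgl_mul1 : left_id pgl_one pgl_mul.
Proof. by move=> x; rewrite -(pgl_reprK x) -pgl_piM mul1g. Qed.
Fact pgl_mulr1 : right_id pgl_one pgl_mul.
Proof. by move=> x; rewrite -(pgl_reprK x) -pgl_piM mulg1. Qed.
Fact pgl_mulV : left_inverse pgl_one pgl_inv pgl_mul.
Proof. by move=> x; rewrite -{2}(pgl_reprK x) -pgl_piM mulVg. Qed.
Fact pgl_mulrV : right_inverse pgl_one pgl_inv pgl_mul.
Proof. by move=> x; rewrite -{1}(pgl_reprK x) -pgl_piM mulgV. Qed.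

HB.instance Definition _ :=
  isGroup.Build PGL pgl_mulA pgl_mul1 pgl_mulr1 pgl_mulV pgl_mulrV.

(* The quotient smooth structure: a function on PGL(V) is smooth iff its
   pullback to GL(V) is. *)
Definition pgl_sheaf : set PGL -> set (PGL -> R^o) :=
  fun U => [set f : PGL -> R^o | gl_sheaf (pgl_pi @^-1` U) (f \o pgl_pi)].

End PGL.

Definition is_lift (R : realType) (V : vectType R[i]) (G : lieGroup R)
    (rho : G -> PGL V) (rhot : G -> GL V) : Prop :=
  lie_hom (@lie_sheaf R G) (@gl_sheaf R V) rhot /\
  forall x, pgl_pi (rhot x) = rho x.

(* Main.v *)
Require Import Defs.
From HB Require Import structures.
From mathcomp Require Import all_boot all_order all_algebra.
From mathcomp Require Import all_classical all_reals all_analysis.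
From mathcomp Require Import complex ring lra zify.

(** Existence. Dividing a matrix by a suitable n-th root of its determinant gives,
    near the identity, a smooth section of GL(V) -> PGL(V) with values of
    determinant 1 ([pgl_section]). A smooth scalar normalisation is obtained by
    first making a corner entry equal to 1, which leaves a determinant close to 1,
    and by then taking the principal root. Composing with rho gives a smooth map phi
    from a neighbourhood of 1 in G to GL(V). For x and y near 1, phi(x) phi(y) and
    phi(xy) differ by an n-th root of unity that is close to 1, hence equal to 1: phi
    is a local homomorphism ([local_lift_mul]). On a simply connected group a local
    homomorphism extends to a homomorphism ([extend_local_hom]): multiply the
    values of phi on the small increments of a path from 1 to x; a homotopy,
    sampled on a fine grid, shows that the product depends only on the endpoint.
    The extension is smooth near 1, hence everywhere by translation.

    Uniqueness. Two lifts differ by a smooth character chi : G -> C^*. A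
    left-invariant field D acts on the real span of Re chi and Im chi as
    multiplication by a complex number ([field_on_character]), so brackets of
    left-invariant fields kill both functions, and for semisimple G every
    left-invariant field is a sum of elements of simple ideals and kills them too
    ([semisimple_kills_character]). As every tangent vector at 1 extends to a
    left-invariant field ([left_field]), chi has zero differential and is 1 near the
    identity ([killed_locally_constant]). The lifts agree near 1, and a neighbourhood
    of 1 generates the path-connected group G ([homs_eq_near1]). *)

Set Implicit Arguments.
Unset Strict Implicit.
Unset Printing Implicit Defensive.
Import Order.TTheory GRing.Theory Num.Theory.
Import numFieldNormedType.Exports.
Local Open Scope classical_set_scope.
Local Open Scope ring_scope.

Import passmx.

(** * C^k functions on open sets of normed modules *)

Lemma near_eq_differentiable (R : realType) (E F : normedModType R) (f g : E -> F) (x : E) :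
  {near x, f =1 g} -> differentiable f x -> differentiable g x.
Proof.
move=> fg df; have fgx := nbhs_singleton fg.
have [cdf /eqaddoP ef] := (diff_locallyP _ _).1 df.
have eg : g \o shift x = cst (g x) + 'd f x +o_ 0 id.
  apply/eqaddoP => e e0.
  have {}fg : \forall h \near (0 : E), f (h + x) = g (h + x).
    by move: fg; rewrite (near_shift 0 x) => fg; apply: filterS fg => h /=; rewrite subr0.
  apply: (@filterS _ (nbhs (0 : E)) _ _ _ _ (filterI fg (ef _ e0))) => h /= [fgh].
  by rewrite !fctE /= /cst /= -fgx fgh.
have dgf : 'd g x = 'd f x :> (E -> F) by apply: diff_unique.
by apply/diff_locallyP; rewrite dgf; split; [exact: cdf | exact: eg].
Qed.

Lemma near_open (T : topologicalType) (U : set T) (x : T) :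
  open U -> U x -> \forall y \near x, U y.
Proof. by move=> oU Ux; apply: open_nbhs_nbhs. Qed.

Section Ck.
Variables (R : realType) (E : normedModType R).

Lemma Ck_on_sub (F : normedModType R) k (U V : set E) (f : E -> F) :
  V `<=` U -> Ck_on k U f -> Ck_on k V f.
Proof.
elim: k f => [|k IH] f VU /=; first by move=> h x /VU; apply: h.
by move=> [h1 h2]; split=> [x /VU|v]; [apply: h1|apply: IH].
Qed.

Lemma Ck_on_congr (F : normedModType R) k (U : set E) (f g : E -> F) :
  open U -> (forall x, U x -> f x = g x) -> Ck_on k U f -> Ck_on k U g.
Proof.
move=> oU; elim: k f g => [|k IH] f g fg /=.
  move=> cf x Ux; have nfg : {near x, f =1 g}.
    by apply: filterS (near_open oU Ux) => y; apply: fg.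
  rewrite /prop_for /continuous_at -(fg _ Ux).
  apply: cvg_trans (cf x Ux); apply: near_eq_cvg.
  by apply: filterS nfg => y ->.
move=> [df Ddf]; split=> [x Ux|v].
  have nfg : {near x, f =1 g}.
    by apply: filterS (near_open oU Ux) => y; apply: fg.
  exact: (near_eq_differentiable nfg (df x Ux)).
apply: IH (Ddf v) => x Ux; apply: near_eq_derive.
by apply: filterS (near_open oU Ux) => y; apply: fg.
Qed.

(** Every clause of [Ck_on] is a condition at the points of the set. *)
Lemma Ck_on_local (F : normedModType R) k (U : set E) (f : E -> F) :
  (forall x, U x -> exists2 V : set E, V x & Ck_on k V f) -> Ck_on k U f.
Proof.
elim: k f => [|k IH] f h /=.
  by move=> x /h[V Vx]; apply.
split=> [x /h[V Vx [dV _]]|v]; first exact: (dV x Vx).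
by apply: IH => x /h[V Vx [_ h2]]; exists V => //; apply: h2.
Qed.

Lemma Ck_onW (F : normedModType R) k (U : set E) (f : E -> F) :
  Ck_on k.+1 U f -> Ck_on k U f.
Proof.
elim: k f => [|k IH] f /=.
  by move=> [df _] x Ux; apply: differentiable_continuous; apply: df.
by move=> [df Df]; split=> // v; apply: (IH _ (Df v)).
Qed.

Lemma Ck_on_cst (F : normedModType R) k (U : set E) (a : F) : Ck_on k U (cst a).
Proof.
elim: k a => [|k IH] a /=; first by move=> x _; apply: cst_continuous.
split=> [x _|v]; first exact: differentiable_cst.
suff -> : (fun x => 'D_v (cst a) x) = cst 0 by apply: IH.
by apply/funext => x; rewrite derive_cst.
Qed.

Lemma Ck_onD (F : normedModType R) k (U : set E) (f g : E -> F) : open U ->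
  Ck_on k U f -> Ck_on k U g -> Ck_on k U (f + g).
Proof.
move=> oU; elim: k f g => [|k IH] f g /=.
  by move=> cf cg x Ux; apply: continuousD; [apply: cf|apply: cg].
move=> [df Df] [dg Dg]; split=> [x Ux|v].
  by apply: differentiableD; [apply: df|apply: dg].
apply: Ck_on_congr (IH _ _ (Df v) (Dg v)) => // x Ux.
by rewrite deriveD//; apply: diff_derivable; [apply: df|apply: dg].
Qed.

Lemma Ck_onM k (U : set E) (f g : E -> R^o) : open U ->
  Ck_on k U f -> Ck_on k U g -> Ck_on k U (f * g : E -> R^o).
Proof.
move=> oU; elim: k f g => [|k IH] f g.
  by move=> cf cg x Ux; apply: continuousM; [apply: cf|apply: cg].
move=> Cf Cg; have [/= df Df] := Cf; have [/= dg Dg] := Cg; split=> [x Ux|v].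
  by apply: differentiableM; [apply: df|apply: dg].
have C1 := IH _ _ (Ck_onW Cf) (Dg v).
have C2 := IH _ _ (Ck_onW Cg) (Df v).
apply: Ck_on_congr (Ck_onD oU C1 C2) => // x Ux.
by rewrite deriveM//; apply: diff_derivable; [apply: df|apply: dg].
Qed.

Lemma Ck_on_sum (F : normedModType R) k (U : set E) (I : Type) (r : seq I)
    (P : pred I) (f : I -> E -> F) :
  open U -> (forall i, P i -> Ck_on k U (f i)) ->
  Ck_on k U (fun x => \sum_(i <- r | P i) f i x).
Proof.
move=> oU Cf; have -> : (fun x => \sum_(i <- r | P i) f i x) = \sum_(i <- r | P i) f i.
  by apply/funext => x; rewrite fct_sumE.
elim/big_ind : _ => //; first exact: Ck_on_cst.
by move=> ? ?; apply: Ck_onD.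
Qed.

(** Asking that [h' \o f] be C^k, rather than that [h'] be, is what lets
    functions solving a differential equation, like exp or cos and sin, be
    treated by induction on k. *)
Lemma Ck_on_comp1 k (U : set E) (h h' : R -> R) (f : E -> R^o) : open U ->
  (forall x, U x -> is_derive (f x) 1 h (h' (f x))) ->
  Ck_on k.+1 U f -> (Ck_on k U (fun x => h' (f x) : R^o)) ->
  Ck_on k.+1 U (fun x => h (f x) : R^o).
Proof.
move=> oU dh [df Df] Ch'.
have dhx x : U x -> differentiable (h : R^o -> R^o) (f x).
  by move=> Ux; apply/derivable1_diffP; have [] := dh x Ux.
split=> [x Ux|v]; first exact: (differentiable_comp (df x Ux) (dhx x Ux)).
apply: Ck_on_congr (Ck_onM oU Ch' (Df v)) => // x Ux.
have dcomp := differentiable_comp (df x Ux) (dhx x Ux).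
rewrite [RHS](deriveE _ dcomp) (diff_comp (df x Ux) (dhx x Ux)) /=.
rewrite (@diff1E _ _ (h : R^o -> R^o)); last exact: dhx.
rewrite derive1E (@derive_val _ _ _ _ _ _ _ (dh x Ux)) -deriveE; last exact: df.
by rewrite mulrC.
Qed.

End Ck.

Section Ck2.
Variables (R : realType) (E : normedModType R).

(** The inner function enters through its components [a i] in a finite family of
    vectors [e i]: then [D_v (g o f) = sum_i D_v (a i) * (D_(e i) g o f)] involves
    only real-valued functions, to which the induction on k applies. *)
Lemma Ck_on_comp (F : normedModType R) (I : finType) (e : I -> F) k
   (U : set E) (W : set F) (a : I -> E -> R^o) (f : E -> F) (g : F -> R^o) :
  open U -> (forall x, U x -> f x = \sum_i a i x *: e i) ->
  (forall x, U x -> W (f x)) -> (forall i, Ck_on k U (a i)) ->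
  Ck_on k W g -> Ck_on k U (g \o f).
Proof.
move=> oU fE fUW; have neq x : U x -> {near x, (fun y => \sum_i a i y *: e i) =1 f}.
  by move=> Ux; apply: filterS (near_open oU Ux) => y /fE.
have sumE : (fun y => \sum_i a i y *: e i) = \sum_i (fun y => a i y *: e i).
  by apply/funext => y; rewrite fct_sumE.
elim: k g => [|k IH] g.
  move=> /= ca cg x Ux; apply: continuous_comp; last exact: cg (fUW x Ux).
  have cs : {for x, continuous (fun y => \sum_i a i y *: e i)}.
    rewrite sumE; elim/big_ind : _ => [|? ? ? ?|i _].
    - exact: cst_continuous.
    - exact: continuousD.
    - by apply: continuousZr_tmp; exact: ca.
  rewrite /prop_for /continuous_at fE//.
  by apply: cvg_trans cs; apply: near_eq_cvg; apply: filterS (neq x Ux) => y ->.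
move=> ca [dg Dg].
have da x : U x -> differentiable (fun y => \sum_i a i y *: e i) x.
  move=> Ux; rewrite sumE; elim/big_ind : _ => [|? ? ? ?|i _].
  - exact: differentiable_cst.
  - exact: differentiableD.
  - by apply: differentiableZl; have [+ _] := ca i; apply.
have df x : U x -> differentiable f x.
  by move=> Ux; exact: (near_eq_differentiable (neq x Ux) (da x Ux)).
split=> [x Ux|v].
  by apply: differentiable_comp; [exact: df|exact: dg (fUW x Ux)].
have CD i : Ck_on k U (fun x => 'D_v (a i) x * 'D_(e i) g (f x) : R^o).
  apply: Ck_onM => //; first by have [_] := ca i; apply.
  by apply: (IH ('D_(e i) g)) => [j|]; [apply: Ck_onW; exact: ca|exact: Dg].
have := Ck_on_sum (index_enum I) (P := xpredT) oU (fun i _ => CD i).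
apply: Ck_on_congr => // x Ux.
rewrite [RHS]deriveE; last by apply: differentiable_comp; [exact: df|exact: dg (fUW x Ux)].
rewrite (diff_comp (df x Ux) (dg _ (fUW x Ux))).
rewrite /= -(deriveE _ (df x Ux)).
have -> : 'D_v f x = \sum_i 'D_v (a i) x *: e i.
  rewrite -(near_eq_derive v (neq x Ux)) sumE.
  suff /@derive_val : is_derive x v (\sum_i (fun y => a i y *: e i))
    (\sum_i 'D_v (a i) x *: e i) by [].
  elim/big_ind2 : _ => [|h1 h2 l1 l2 d1 d2|i _]; first exact: is_derive_cst.
    exact: is_deriveD.
  have dai : differentiable (a i) x by have [+ _] := ca i; apply.
  have dZ := differentiableZl (e i) dai.
  apply: DeriveDef; first exact: diff_derivable.
  by rewrite (deriveE _ dZ) diffZl// deriveE.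
rewrite raddf_sum; apply: eq_bigr => i _.
rewrite (deriveE _ (dg _ (fUW x Ux))). by rewrite [RHS]linearZ.
Qed.
End Ck2.

Section ZeroDerivative.
Variables (R : realType) (E : normedModType R).

(** Mean value theorem along the segment from the centre. *)
Lemma zero_diff_constant (g : E -> R^o) (p q : E) (r : R) :
  (forall y, ball p r y -> differentiable g y /\ forall w, 'D_w g y = 0) ->
  ball p r q -> g q = g p.
Proof.
move=> dg bq; (* the segment from p to q, which stays in the ball *)
pose l t : E := p + (t : R^o) *: (q - p).
have bl (t : R) : t \in `[(0 : R), 1] -> ball p r (l t).
  rewrite in_itv /= => /andP[t0 t1].
  rewrite -ball_normE /= /l opprD addrA subrr sub0r normrN normrZ.
  move: bq; rewrite /= -ball_normE /= distrC; apply: le_lt_trans.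
  by rewrite -[leRHS]mul1r ler_wpM2r// ger0_norm.
have dl t : differentiable (l : R^o -> E) t.
  apply: (@differentiableD _ _ _ (cst p) (fun t : R^o => (t : R^o) *: (q - p))) => //.
have dgl (t : R) : t \in `[(0 : R), 1] -> differentiable (g \o l : R^o -> R^o) (t : R^o).
  by move=> /bl/dg[dgt _]; apply: differentiable_comp.
have D0 (t : R) : t \in `[(0 : R), 1] -> is_derive (t : R^o) (1 : R^o) (g \o l : R^o -> R^o) 0.
  move=> t01; apply: DeriveDef; first exact/diff_derivable/dgl.
  have [dgt g0] := dg _ (bl t t01).
  by rewrite (deriveE _ (dgl t t01)) (diff_comp (dl t) dgt) /= -(deriveE _ dgt).
pose h : R -> R := fun t => g (l t).
have dh t : t \in `](0 : R), 1[ -> is_derive t 1 h 0.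
  by move=> t01; exact: (D0 t (subset_itv_oo_cc t01)).
have ch : {within `[0, 1], continuous h}.
  apply: continuous_in_subspaceT => t; rewrite inE => t01.
  exact: (differentiable_continuous (dgl t t01)).
have [c _] := MVT ltr01 dh ch.
rewrite mul0r => /eqP; rewrite subr_eq0 => /eqP.
by rewrite /h /l scale1r scale0r addr0 subrKC.
Qed.

Lemma Ck_on_coord m k (U : set E) (f : E -> 'rV[R]_m) j : open U ->
  Ck_on k U f -> Ck_on k U (fun x => f x ord0 j : R^o).
Proof.
move=> oU; have dc M : differentiable (fun M : 'rV[R]_m => M ord0 j : R^o) M.
  exact: differentiable_coord.
elim: k f => [|k IH] f /=.
  move=> cf x Ux; exact: (continuous_comp (cf x Ux) (@coord_continuous _ _ _ ord0 j (f x))).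
move=> [df Df]; split=> [x Ux|v].
  exact: (differentiable_comp (df x Ux) (dc _)).
apply: Ck_on_congr (IH _ (Df v)) => // x Ux.
have dcf := differentiable_comp (df x Ux) (dc (f x)).
rewrite [RHS](deriveE _ dcf) (diff_comp (df x Ux) (dc _)) /= (deriveE _ (df x Ux)).
have lc : linear (fun M : 'rV[R]_m => M ord0 j : R^o) by move=> a M N; rewrite !mxE.
pose fM := GRing.isLinear.Build _ _ _ _ _ lc.
pose fL : {linear 'rV[R]_m -> R^o} := HB.pack (fun M : 'rV[R]_m => M ord0 j : R^o) fM.
by rewrite (diff_lin (f := fL)) //; exact: coord_continuous.
Qed.

End ZeroDerivative.

Lemma derive_slice (R : realType) (E1 E2 : normedModType R) (F : E1 * E2 -> R^o) p q w :
  'D_(0, w) F (p, q) = 'D_w (fun y => F (p, y)) q.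
Proof.
rewrite /derive; have -> // : (fun h : R => h^-1 *: ((F \o shift (p, q)) (h *: (0, w)) - F (p, q))) =
  (fun h : R => h^-1 *: (((fun y => F (p, y)) \o shift q) (h *: w) - F (p, q))).
apply/funext => h; congr (_ *: (F _ - _)).
by rewrite /= -[LHS]/(h *: 0 + p, h *: w + q) scaler0 add0r.
Qed.

Section SmoothMisc.
Variables (R : realType) (E : normedModType R).

(** All directional derivatives of a continuous linear form are constant. *)
Lemma smooth_linear (f : E -> R^o) (U : set E) : linear f -> continuous f -> smooth_on U f.
Proof.
move=> lf cf; pose fM := GRing.isLinear.Build _ _ _ _ f lf.
pose fL : {linear E -> R^o} := HB.pack f fM.
have df x : differentiable fL x by exact: linear_differentiable.
case=> [|k]; first by move=> x _; exact: cf.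
split=> [x _|v]; first exact: (df x).
suff -> : (fun x => 'D_v f x) = cst (f v) by exact: Ck_on_cst.
by apply/funext => x; rewrite (deriveE _ (df x)) (diff_lin (f := fL)).
Qed.

Lemma smooth_continuous (F : normedModType R) (U : set E) (f : E -> F) x :
  smooth_on U f -> U x -> {for x, continuous f}.
Proof. by move=> sf; exact: (sf 0%N). Qed.

Lemma smooth_on_congr (F : normedModType R) (U : set E) (f g : E -> F) :
  open U -> (forall x, U x -> f x = g x) -> smooth_on U f -> smooth_on U g.
Proof. by move=> oU fg sf k; apply: Ck_on_congr (sf k). Qed.

Lemma smooth_on_sub (F : normedModType R) (U V : set E) (f : E -> F) :
  V `<=` U -> smooth_on U f -> smooth_on V f.
Proof. by move=> VU sf k; apply: Ck_on_sub (sf k). Qed.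

Lemma smooth_on_local (F : normedModType R) (U : set E) (f : E -> F) :
  (forall x, U x -> exists2 V : set E, V x & smooth_on V f) -> smooth_on U f.
Proof. by move=> h k; apply: Ck_on_local => x /h[V Vx sV]; exists V. Qed.

Lemma smooth_on_comp (F : normedModType R) (I : finType) (e : I -> F)
   (U : set E) (W : set F) (a : I -> E -> R^o) (f : E -> F) (g : F -> R^o) :
  open U -> (forall x, U x -> f x = \sum_i a i x *: e i) ->
  (forall x, U x -> W (f x)) -> (forall i, smooth_on U (a i)) ->
  smooth_on W g -> smooth_on U (g \o f).
Proof. by move=> oU fE fUW sa sg k; exact: (Ck_on_comp oU fE fUW (fun i => sa i k)). Qed.

Lemma open_setI_preimage (T S : topologicalType) (U : set T) (f : T -> S) (B : set S) : open U ->
  (forall x, U x -> {for x, continuous f}) -> open B -> open (U `&` f @^-1` B).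
Proof.
move=> oU cf oB; rewrite openE => x [Ux Bfx].
apply: filterI; first exact: open_nbhs_nbhs.
by apply: (cf x Ux); apply: open_nbhs_nbhs.
Qed.

Lemma open_positive (T : topologicalType) (U : set T) (f : T -> R^o) : open U ->
  (forall x, U x -> {for x, continuous f}) -> open [set x | U x /\ 0 < f x].
Proof. by move=> oU cf; exact: (open_setI_preimage oU cf (@open_gt R 0)). Qed.

End SmoothMisc.

Section PairFrame.
Variables (R : realType) (m1 m2 : nat).

Definition pair_coord (z : 'rV[R]_m1 * 'rV[R]_m2) (k : 'I_m1 + 'I_m2) : R^o :=
  match k with inl j => z.1 ord0 j | inr j => z.2 ord0 j end.
(** The standard basis of the product, indexed as [pair_coord]; it feeds
    [Ck_on_comp] whenever the outer function lives on a product. *)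
Definition pair_frame (k : 'I_m1 + 'I_m2) : ('rV[R]_m1 * 'rV[R]_m2)%type :=
  match k with inl j => (delta_mx ord0 j, 0) | inr j => (0, delta_mx ord0 j) end.

Lemma pair_frameE z : z = \sum_k pair_coord z k *: pair_frame k.
Proof.
rewrite big_sumType /=; case: z => z1 z2 /=.
have -> : \sum_(j < m1) z1 ord0 j *: ((delta_mx ord0 j, 0) : 'rV[R]_m1 * 'rV[R]_m2) = (z1, 0).
  rewrite {2}(row_sum_delta z1); elim/big_rec2 : _ => // j y1 y2 _ ->.
  by congr pair; rewrite /= scaler0 addr0.
have -> : \sum_(j < m2) z2 ord0 j *: ((0, delta_mx ord0 j) : 'rV[R]_m1 * 'rV[R]_m2) = (0, z2).
  rewrite {2}(row_sum_delta z2); elim/big_rec2 : _ => // j y1 y2 _ ->.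
  by congr pair; rewrite /= scaler0 addr0.
by congr pair; rewrite /= ?addr0 ?add0r.
Qed.

Lemma smooth_pair_coord (U : set ('rV[R]_m1 * 'rV[R]_m2)%type) k :
  smooth_on U (fun z => pair_coord z k).
Proof.
case: k => j; apply: smooth_linear => /= [a u v|z]; rewrite ?mxE//.
- apply: (@continuous_comp _ _ _ fst (fun M : 'rV[R]_m1 => M ord0 j)); first exact: cvg_fst.
  exact: coord_continuous.
- apply: (@continuous_comp _ _ _ snd (fun M : 'rV[R]_m2 => M ord0 j)); first exact: cvg_snd.
  exact: coord_continuous.
Qed.

Lemma smooth_row_coord (U : set 'rV[R]_m1) j : smooth_on U (fun z : 'rV[R]_m1 => z ord0 j : R^o).
Proof. by apply: smooth_linear => [a u v|]; rewrite ?mxE//; exact: coord_continuous. Qed.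

End PairFrame.

(** * Algebras of real functions and their complexification *)

(** Continuity at a point, smoothness on an open set and membership in a sheaf of
    smooth functions are closed under the same operations; this predicate allows
    one proof for the complex polynomials and determinants built from them. *)
Definition fun_algebra (R : realType) (T : Type) (P : set (T -> R^o)) : Prop :=
  [/\ (forall a : R, P (fun=> a)),
      (forall f g, P f -> P g -> P (fun x => f x + g x)) &
      (forall f g, P f -> P g -> P (fun x => f x * g x))].

(** Inverses are taken of functions without zeros on the region [D] where the
    property is tested; elsewhere the inverse of 0 is 0. *)
Definition inv_closed (R : realType) (T : Type) (D : set T) (P : set (T -> R^o)) : Prop :=
  forall f, P f -> (forall x, D x -> f x != 0) -> P (fun x => (f x)^-1).

Definition cplx (R : realType) (T : Type) (P : set (T -> R^o)) (g : T -> R[i]) : Prop :=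
  P (fun x => complex.Re (g x)) /\ P (fun x => complex.Im (g x)).

Section Cplx.
Variables (R : realType) (T : Type) (P : set (T -> R^o)) (PA : fun_algebra P).
Implicit Types g h : T -> R[i].

Lemma fun_algebraN f : P f -> P (fun x => - f x).
Proof.
have [Pc _ PM] := PA; move=> Pf; have := PM _ _ (Pc (-1)) Pf.
by congr (P _); apply/funext => x; rewrite mulN1r.
Qed.

Lemma eq_cplx g h : g =1 h -> cplx P g -> cplx P h.
Proof. by move=> /funext ->. Qed.

Lemma cplx_cst (a : R[i]) : cplx P (fun=> a).
Proof. by have [Pc _ _] := PA; split; apply: Pc. Qed.

Lemma cplxD g h : cplx P g -> cplx P h -> cplx P (fun x => g x + h x).
Proof.
have [_ PD _] := PA; move=> [g1 g2] [h1 h2]; split.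
  by have := PD _ _ g1 h1; congr (P _); apply/funext => x; case: (g x) (h x) => ? ? [].
by have := PD _ _ g2 h2; congr (P _); apply/funext => x; case: (g x) (h x) => ? ? [].
Qed.

Lemma cplxM g h : cplx P g -> cplx P h -> cplx P (fun x => g x * h x).
Proof.
have [_ PD PM] := PA; move=> [g1 g2] [h1 h2]; split.
  have := PD _ _ (PM _ _ g1 h1) (fun_algebraN (PM _ _ g2 h2)).
  by congr (P _); apply/funext => x; case: (g x) (h x) => ? ? [].
have := PD _ _ (PM _ _ g1 h2) (PM _ _ g2 h1).
by congr (P _); apply/funext => x; case: (g x) (h x) => ? ? [].
Qed.

Lemma cplx_sum (I : Type) (r : seq I) (Q : pred I) (g : I -> T -> R[i]) :
  (forall i, Q i -> cplx P (g i)) -> cplx P (fun x => \sum_(i <- r | Q i) g i x).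
Proof.
move=> Pg; elim: r => [|i r IH].
  by apply: (eq_cplx (g := fun=> 0)) => [x|]; [rewrite big_nil|exact: cplx_cst].
apply: (eq_cplx (g := fun x => if Q i then g i x + \sum_(j <- r | Q j) g j x
                               else \sum_(j <- r | Q j) g j x)) => [x|].
  by rewrite big_cons.
by case: (Q i) (Pg i) => [h|_ //]; apply: cplxD => //; exact: h.
Qed.

Lemma cplx_prod (I : Type) (r : seq I) (Q : pred I) (g : I -> T -> R[i]) :
  (forall i, Q i -> cplx P (g i)) -> cplx P (fun x => \prod_(i <- r | Q i) g i x).
Proof.
move=> Pg; elim: r => [|i r IH].
  by apply: (eq_cplx (g := fun=> 1)) => [x|]; [rewrite big_nil|exact: cplx_cst].
apply: (eq_cplx (g := fun x => if Q i then g i x * \prod_(j <- r | Q j) g j x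
                               else \prod_(j <- r | Q j) g j x)) => [x|].
  by rewrite big_cons.
by case: (Q i) (Pg i) => [h|_ //]; apply: cplxM => //; exact: h.
Qed.

Lemma cplxX g n : cplx P g -> cplx P (fun x => g x ^+ n).
Proof.
move=> Pg; elim: n => [|n IH].
  exact: cplx_cst.
by apply: (eq_cplx (g := fun x => g x * g x ^+ n)) => [x|]; [rewrite exprS|exact: cplxM].
Qed.

Lemma cplx_det n (A : T -> 'M[R[i]]_n) :
  (forall i j, cplx P (fun x => A x i j)) -> cplx P (fun x => \det (A x)).
Proof.
move=> PAij; apply: cplx_sum => s _; apply: cplxM; first exact: cplx_cst.
exact: cplx_prod.
Qed.

Lemma cplxV (D : set T) g : inv_closed D P -> cplx P g -> (forall x, D x -> g x != 0) ->
  cplx P (fun x => (g x)^-1).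
Proof.
have [_ PD PM] := PA; move=> PV [g1 g2] g0.
have /PV n2 : P (fun x =>
    complex.Re (g x) * complex.Re (g x) + complex.Im (g x) * complex.Im (g x)).
  by apply: PD; apply: PM.
have {}n2 : P (fun x =>
    (complex.Re (g x) * complex.Re (g x) + complex.Im (g x) * complex.Im (g x))^-1).
  apply: n2 => x Dx; have := g0 x Dx; apply: contra => /eqP e.
  have := sqr_ge0 (complex.Re (g x)); have := sqr_ge0 (complex.Im (g x)).
  rewrite !expr2 => i0 r0.
  have /eqP : complex.Re (g x) * complex.Re (g x) = 0 by lra.
  have /eqP : complex.Im (g x) * complex.Im (g x) = 0 by lra.
  by rewrite !mulf_eq0 !orbb; case: (g x) => a b /= /eqP-> /eqP->.
split.
  have := PM _ _ g1 n2; congr (P _); apply/funext => x; case: (g x) => a b //=.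
have := fun_algebraN (PM _ _ g2 n2); congr (P _); apply/funext => x; case: (g x) => a b //=.
Qed.
End Cplx.

Section ContinuousAlgebra.
Variables (R : realType) (T : topologicalType) (x : T).

Lemma continuous_algebra : fun_algebra (fun f : T -> R^o => {for x, continuous f}).
Proof.
split=> [a|f g cf cg|f g cf cg]; first exact: cst_continuous.
  exact: continuousD.
exact: continuousM.
Qed.

Lemma continuous_inv_closed : inv_closed [set x] (fun f : T -> R^o => {for x, continuous f}).
Proof. by move=> f cf f0; apply: continuousV => //; exact: f0. Qed.

End ContinuousAlgebra.

Lemma cplx_continuous_comp (R : realType) (S T : topologicalType) (g : T -> R[i]) (h : S -> T) x :
  {for x, continuous h} -> cplx (fun f : T -> R^o => {for h x, continuous f}) g ->
  cplx (fun f : S -> R^o => {for x, continuous f}) (g \o h).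
Proof.
by move=> ch [c1 c2]; split; [exact: (continuous_comp ch c1)|exact: (continuous_comp ch c2)].
Qed.

Section Smooth.
Variables (R : realType) (E : normedModType R) (U : set E) (oU : open U).

Lemma smooth_fun_algebra : fun_algebra (@smooth_on R E R^o U).
Proof.
split=> [a k|f g cf cg k|f g cf cg k]; first exact: Ck_on_cst.
  exact: (Ck_onD oU (cf k) (cg k)).
exact: (Ck_onM oU (cf k) (cg k)).
Qed.

(** The last hypothesis asks for the bootstrap step of the induction: the
    derivative [h'] must be expressible through [h] and [f]. *)
Lemma smooth_on_comp1 (h h' : R -> R) (f : E -> R^o) :
  (forall x, U x -> is_derive (f x) 1 h (h' (f x))) ->
  smooth_on U f ->
  (forall k, Ck_on k U (fun x => h (f x) : R^o) -> Ck_on k U (fun x => h' (f x) : R^o)) ->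
  smooth_on U (fun x => h (f x) : R^o).
Proof.
move=> dh sf hh'; elim=> [|k IH]; last exact: (Ck_on_comp1 oU dh (sf _) (hh' _ IH)).
move=> x Ux; apply: continuous_comp; first exact: (sf 0%N).
by apply/differentiable_continuous/derivable1_diffP; case: (dh x Ux).
Qed.

Lemma smooth_inv_closed : inv_closed U (@smooth_on R E R^o U).
Proof.
move=> f sf f0.
apply: (smooth_on_comp1 (h := fun y => y^-1) (h' := fun y => - (y^-1 * y^-1))) => //.
  move=> x Ux; apply: is_derive_eq (is_deriveV (f := id) (f0 _ Ux) (is_derive_id _ _)) _.
  by rewrite -invfM -expr2 /= [_ *: _]mulr1.
move=> k C; have [Pc _ PM] := smooth_fun_algebra.
have := Ck_onM oU (Ck_on_cst k U (-1 : R^o)) (Ck_onM oU C C).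
by congr (Ck_on _ _ _); apply/funext => x; rewrite !fctE mulN1r.
Qed.

Lemma smooth_on_expR (f : E -> R^o) : smooth_on U f -> smooth_on U (fun x => expR (f x) : R^o).
Proof. by move=> sf; apply: (smooth_on_comp1 (h' := expR)) => // x _; exact: is_derive_expR. Qed.

Lemma smooth_on_ln (f : E -> R^o) : smooth_on U f -> (forall x, U x -> 0 < f x) ->
  smooth_on U (fun x => ln (f x) : R^o).
Proof.
move=> sf f0; apply: (smooth_on_comp1 (h' := fun y => y^-1)) => //.
  by move=> x /f0; exact: is_derive1_ln.
by move=> k _; apply: smooth_inv_closed => // x /f0; rewrite lt0r => /andP[].
Qed.

Lemma smooth_on_atan (f : E -> R^o) : smooth_on U f -> smooth_on U (fun x => atan (f x) : R^o).
Proof.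
move=> sf; apply: (smooth_on_comp1 (h' := fun y => (1 + y ^+ 2)^-1)) => //.
have [Pc PD PM] := smooth_fun_algebra.
move=> k _; apply: smooth_inv_closed => [|x _]; last by apply: lt0r_neq0; have := sqr_ge0 (f x); lra.
by apply: PD; [exact: Pc|exact: PM].
Qed.

(** Cosine and sine are each other's derivatives up to sign, hence one induction
    for both. *)
Lemma smooth_on_cos_sin (f : E -> R^o) : smooth_on U f ->
  smooth_on U (fun x => cos (f x) : R^o) /\ smooth_on U (fun x => sin (f x) : R^o).
Proof.
move=> sf; suff h k : Ck_on k U (fun x => cos (f x) : R^o) /\
    Ck_on k U (fun x => sin (f x) : R^o).
  by split=> k; have [] := h k.
elim: k => [|k [IHc IHs]].
  split=> x Ux; apply: continuous_comp; try exact: (sf 0%N).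
    exact: continuous_cos.
  exact: continuous_sin.
split; last by apply: (Ck_on_comp1 (h' := cos)) => // x _; exact: is_derive_sin.
apply: (Ck_on_comp1 (h' := fun y => - sin y)) => //.
have := Ck_onM oU (Ck_on_cst k U (-1 : R^o)) IHs.
by congr (Ck_on _ _ _); apply/funext => x; rewrite !fctE mulN1r.
Qed.

End Smooth.

Lemma cplx_smooth_congr (R : realType) (E : normedModType R) (U : set E) (g h : E -> R[i]) :
  open U -> (forall x, U x -> g x = h x) -> cplx (smooth_on U) g -> cplx (smooth_on U) h.
Proof.
by move=> oU gh [s1 s2]; split; [apply: smooth_on_congr s1|apply: smooth_on_congr s2] => // x /gh ->.
Qed.

Lemma cplx_open_neq0 (R : realType) (T : topologicalType) (U : set T) (g : T -> R[i]) : open U ->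
  (forall x, U x -> cplx (fun f : T -> R^o => {for x, continuous f}) g) ->
  open [set x | U x /\ g x != 0].
Proof.
move=> oU cg.
(* the squared modulus turns g x <> 0 into an open condition on a real function *)
pose n2 x : R^o := complex.Re (g x) * complex.Re (g x) + complex.Im (g x) * complex.Im (g x).
have -> : [set x | U x /\ g x != 0] = [set x | U x /\ 0 < n2 x].
  apply/seteqP; split=> x [Ux h]; split=> //; move: h; rewrite /n2; case: (g x) => a b /=.
    rewrite eq_complex /= negb_and => /orP[a0|b0].
      by rewrite ltr_pwDl// -expr2 ?sqr_ge0// exprn_even_gt0.
    by rewrite ltr_wpDl// -expr2 ?sqr_ge0// exprn_even_gt0.
  by apply: contraTneq => -[-> ->]; rewrite mulr0 addr0 ltxx.
apply: open_positive => // x Ux; have [c1 c2] := cg x Ux.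
by apply: continuousD; apply: continuousM.
Qed.

Lemma cplx_smooth_continuous (R : realType) (E : normedModType R) (U : set E) (g : E -> R[i]) x :
  cplx (smooth_on U) g -> U x -> cplx (fun f : E -> R^o => {for x, continuous f}) g.
Proof.
by move=> [s1 s2] Ux; split; [exact: smooth_continuous s1 Ux|exact: smooth_continuous s2 Ux].
Qed.

(** * The principal n-th root *)

Section Root.
Variable R : realType.

(** Polar form: [exp (log|z| / n)] and [atan (b / a) / n] are the modulus and the
    argument of the principal root, valid on the right half-plane. An explicit
    formula makes smoothness a matter of composition. *)
Definition croot (n : nat) (z : R[i]) : R[i] :=
  let: (a +i* b)%C := z in
  let r := expR (ln (a * a + b * b) / 2 / n%:R) in
  let t := atan (b / a) / n%:R in
  (r * cos t +i* (r * sin t))%C.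

Lemma croot1 n : croot n 1 = 1.
Proof.
rewrite /croot /= !(mulr0, addr0, mul0r, mulr1) ln1 !mul0r atan0 mul0r.
by rewrite expR0 cos0 sin0 mulr0 mulr1.
Qed.

Lemma de_moivre (r t : R) n :
  (r * cos t +i* (r * sin t))%C ^+ n = (r ^+ n * cos (t *+ n) +i* (r ^+ n * sin (t *+ n)))%C.
Proof.
elim: n => [|n IH]; first by rewrite !expr0 mulr0n cos0 sin0 mulr0 mulr1.
rewrite exprS IH mulrS cosD sinD exprS.
by apply/eqP; rewrite eq_complex /=; apply/andP; split; apply/eqP; ring.
Qed.

(** By de Moivre it remains to see that [sqrt (a^2 + b^2)] and [atan (b / a)] are
    polar coordinates of [a + ib] when [0 < a]. *)
Lemma crootK n (z : R[i]) : (0 < n)%N -> 0 < complex.Re z -> croot n z ^+ n = z.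
Proof.
case: z => a b n0 /= a0; rewrite de_moivre.
have nR : n%:R != 0 :> R by rewrite pnatr_eq0 -lt0n.
have eN (x : R) : x / n%:R *+ n = x by rewrite -mulr_natr divfK.
have s0 : 0 < a * a + b * b by rewrite ltr_pwDl ?mulr_gt0// -expr2 sqr_ge0.
have sE : a * a + b * b = (a * Num.sqrt (1 + (b / a) ^+ 2)) ^+ 2.
  rewrite exprMn sqr_sqrtr; last by rewrite addr_ge0// sqr_ge0.
  by field; rewrite gt_eqF.
have q0 : 0 < Num.sqrt (1 + (b / a) ^+ 2) by rewrite sqrtr_gt0 ltr_pwDl// sqr_ge0.
have -> : expR (ln (a * a + b * b) / 2 / n%:R) ^+ n = a * Num.sqrt (1 + (b / a) ^+ 2).
  rewrite -expRM_natr divfK// sE lnXn ?mulr_gt0//.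
  rewrite [_ *+ 2 / 2](_ : _ = ln (a * Num.sqrt (1 + (b / a) ^+ 2))); last by lra.
  by rewrite lnK// posrE mulr_gt0.
rewrite eN; have ca : cos (atan (b / a)) != 0 by rewrite cos_atan invr_eq0 gt_eqF.
have -> : sin (atan (b / a)) = b / a * cos (atan (b / a)).
  by rewrite -{2}(atanK (b / a)) /tan divfK.
rewrite cos_atan; apply/eqP; rewrite eq_complex /=; apply/andP; split; apply/eqP.
  by rewrite mulfK ?gt_eqF.
by field; rewrite !gt_eqF.
Qed.

Lemma smooth_croot (E : normedModType R) (U : set E) n (g : E -> R[i]) :
  open U -> cplx (smooth_on U) g -> (forall x, U x -> 0 < complex.Re (g x)) ->
  cplx (smooth_on U) (fun x => croot n (g x)).
Proof.
move=> oU [sr si] r0; have [Pc PD PM] := smooth_fun_algebra oU.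
have s1 : smooth_on U (fun x => expR (ln (complex.Re (g x) * complex.Re (g x) +
    complex.Im (g x) * complex.Im (g x)) / 2 / n%:R) : R^o).
  apply: smooth_on_expR => //; apply: (PM _ (fun=> n%:R^-1)) => //.
  apply: (PM _ (fun=> 2^-1)) => //; apply: smooth_on_ln => //.
    by apply: PD; apply: PM.
  by move=> x /r0 h; rewrite ltr_pwDl ?mulr_gt0// -expr2 sqr_ge0.
have s2 : smooth_on U (fun x => atan (complex.Im (g x) / complex.Re (g x)) / n%:R : R^o).
  apply: (PM _ (fun=> n%:R^-1)) => //; apply: smooth_on_atan => //.
  by apply: PM => //; apply: smooth_inv_closed => // x /r0; rewrite lt0r => /andP[].
have [s3 s4] := smooth_on_cos_sin oU s2.
split.
  have := PM _ _ s1 s3; congr (smooth_on _ _); apply/funext => x.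
  by rewrite /croot; case: (g x).
have := PM _ _ s1 s4; congr (smooth_on _ _); apply/funext => x.
by rewrite /croot; case: (g x).
Qed.

End Root.

(** * Extending local homomorphisms of simply connected groups *)

Section Discrete.
Variables (G K : groupType) (U : set G) (phi : G -> K).
Hypothesis U1 : U 1%g.
Hypothesis phiM : forall x y, U x -> U y -> U (x * y)%g -> phi (x * y)%g = (phi x * phi y)%g.

(** The product of the values of [phi] on the successive increments of a
    discrete path; for a genuine homomorphism it telescopes to the value on the
    total increment. *)
Fixpoint path_prod (g : nat -> G) (n : nat) : K :=
  if n is m.+1 then (path_prod g m * phi ((g m)^-1 * g m.+1))%g else 1%g.

Definition close (x y : G) := U (x^-1 * y)%g.

Lemma local_hom_chain x y z : close x y -> close y z -> close x z ->
  (phi (x^-1 * y) * phi (y^-1 * z) = phi (x^-1 * z))%g.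
Proof.
rewrite /close => xy yz xz; rewrite -phiM//; last by rewrite mulgA mulgK.
by rewrite mulgA mulgK.
Qed.

Lemma local_hom1 : phi 1%g = 1%g.
Proof.
have := phiM U1 U1; rewrite mulg1 => /(_ U1) e.
by rewrite -[LHS](mulKg (phi 1%g)) -e mulVg.
Qed.

Lemma local_hom_inv x y : close x y -> close y x -> phi (y^-1 * x)%g = (phi (x^-1 * y)%g)^-1%g.
Proof.
move=> xy yx; apply: (mulgI (phi (x^-1 * y)%g)).
by rewrite local_hom_chain// /close ?mulVg// local_hom1 mulgV.
Qed.

Lemma path_prod_telescope g n :
  (forall i j, (i <= n)%N -> (j <= n)%N -> close (g i) (g j)) ->
  path_prod g n = phi ((g 0%N)^-1 * g n)%g.
Proof.
elim: n => [_|n IH h] /=; first by rewrite mulVg local_hom1.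
rewrite IH; last by move=> i j i0 j0; apply: h; lia.
by apply: local_hom_chain; apply: h; lia.
Qed.

Lemma eq_path_prod g h n : (forall i, (i <= n)%N -> g i = h i) ->
  path_prod g n = path_prod h n.
Proof.
elim: n => //= n IH e; rewrite IH => [|i i_n]; first by rewrite !e.
by apply: e; lia.
Qed.

Lemma path_prod_transl a g n : path_prod (fun i => a * g i)%g n = path_prod g n.
Proof. by elim: n => //= n ->; rewrite invgM mulgA mulgVK. Qed.

Lemma path_prod_cat g m n :
  path_prod g (m + n) = (path_prod g m * path_prod (fun i => g (m + i)%N) n)%g.
Proof.
elim: n => [|n IH]; first by rewrite addn0 mulg1.
by rewrite addnS /= IH mulgA addnS.
Qed.

Lemma path_prod_rev g n :
  (forall i, (i < n)%N -> close (g i) (g i.+1) /\ close (g i.+1) (g i)) ->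
  path_prod (fun i => g (n - i)%N) n = ((path_prod g n)^-1)%g.
Proof.
elim: n => [|n IH] h; first by rewrite invg1.
have -> : path_prod (fun i => g (n.+1 - i)%N) n.+1 =
    (phi ((g n.+1)^-1 * g n) * path_prod (fun i => g (n - i)%N) n)%g.
  rewrite -[n.+1]add1n path_prod_cat /= mul1g subn0 add1n subSS subn0.
  by congr (_ * _)%g.
rewrite IH => [|i i_n]; last by apply: h; lia.
by rewrite /= invgM local_hom_inv//; have [] := h n (leqnn _).
Qed.

(** Subdividing a fine path does not change its product, since each block of
    [k] steps telescopes. *)
Lemma path_prod_refine g m k :
  (forall i a b, (i < m)%N -> (a <= k)%N -> (b <= k)%N ->
    close (g (i * k + a)%N) (g (i * k + b)%N)) ->
  path_prod g (m * k) = path_prod (fun i => g (i * k)%N) m.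
Proof.
elim: m => [|m IH] h; first by rewrite mul0n.
rewrite mulSn addnC path_prod_cat /= IH => [|i a b i_m]; last by apply: h; lia.
congr (_ * _)%g; rewrite path_prod_telescope => [|i j i_k j_k]; last by apply: h.
by rewrite addn0 mulSn addnC.
Qed.

(** Going along [g] and then across to the end of [h] equals going across first
    and then along [h]: the small squares between the two rows commute because
    both of their triangles do. *)
Lemma path_prod_row g h n :
  (forall i j, (i <= n)%N -> (j <= n)%N -> (i <= j.+1)%N -> (j <= i.+1)%N ->
     [/\ close (g i) (g j), close (g i) (h j) & close (h i) (h j)]) ->
  (path_prod g n * phi ((g n)^-1 * h n) = phi ((g 0%N)^-1 * h 0%N) * path_prod h n)%g.
Proof.
elim: n => [|n IH] c /=; first by rewrite mul1g mulg1.
have c1 i j : (i <= n.+1)%N -> (j <= n.+1)%N -> (i <= j.+1)%N -> (j <= i.+1)%N ->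
    close (g i) (g j).
  by move=> *; have [] := c i j.
have c2 i j : (i <= n.+1)%N -> (j <= n.+1)%N -> (i <= j.+1)%N -> (j <= i.+1)%N ->
    close (g i) (h j).
  by move=> *; have [] := c i j.
have c3 i j : (i <= n.+1)%N -> (j <= n.+1)%N -> (i <= j.+1)%N -> (j <= i.+1)%N ->
    close (h i) (h j).
  by move=> *; have [] := c i j.
rewrite -mulgA local_hom_chain; [|by apply: c1; lia|by apply: c2; lia|by apply: c2; lia].
rewrite -(@local_hom_chain _ (h n)); [|by apply: c2; lia|by apply: c3; lia|by apply: c2; lia].
rewrite mulgA IH ?mulgA// => i j ? ? ? ?; apply: c; lia.
Qed.

(** A discrete null-homotopy: consecutive rows of the grid have the same product
    by [path_prod_row], their ends being fixed, and the last row is constant. *)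
Lemma path_prod_grid (h : nat -> nat -> G) n :
  (forall i i' j j', (i <= n)%N -> (i' <= n)%N -> (j <= n)%N -> (j' <= n)%N ->
    (i <= i'.+1)%N -> (i' <= i.+1)%N -> (j <= j'.+1)%N -> (j' <= j.+1)%N ->
    close (h i j) (h i' j')) ->
  (forall i, (i <= n)%N -> h i 0%N = h 0%N 0%N /\ h i n = h 0%N 0%N) ->
  (forall j, (j <= n)%N -> h n j = h 0%N 0%N) ->
  path_prod (h 0%N) n = 1%g.
Proof.
move=> c hb hn.
have row i : (i < n)%N -> path_prod (h i) n = path_prod (h i.+1) n.
  move=> i_n; have := @path_prod_row (h i) (h i.+1) n.
  have [-> ->] := hb i (ltnW i_n); have [-> ->] := hb i.+1 i_n.
  rewrite mulVg local_hom1 mulg1 mul1g; apply => j k jn kn jk kj.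
  by split; apply: c; lia.
have -> : path_prod (h 0%N) n = path_prod (h n) n.
  suff rows i : (i <= n)%N -> path_prod (h 0%N) n = path_prod (h i) n by apply: rows.
  by elim: i => // i IH i_n; rewrite IH; [exact: row|exact: ltnW].
have -> : path_prod (h n) n = path_prod (fun=> h 0%N 0%N) n by apply: eq_path_prod.
by elim: (X in path_prod _ X) => //= m ->; rewrite mulVg local_hom1 mulg1.
Qed.

End Discrete.

Section Uniform.
Variables (R : realType) (G : groupTopType).
Hypothesis mulC : continuous (fun p : G * G => (p.1 * p.2)%g).
Hypothesis invC : continuous (fun x : G => (x^-1)%g).
Variable U : set G.
Hypothesis U1 : nbhs 1%g U.

Lemma cvg_mulg (T : Type) (F : set_system T) (FF : Filter F) (f g : T -> G) (a b : G) :
  f @ F --> a -> g @ F --> b -> (fun t => f t * g t)%g @ F --> (a * b)%g.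
Proof.
move=> fa gb; apply: (continuous2_cvg FF (h := fun x y : G => (x * y)%g) _ fa gb); exact (@mulC (a, b)).
Qed.

Lemma cvg_invg (T : Type) (F : set_system T) (FF : Filter F) (f : T -> G) (a : G) :
  f @ F --> a -> (fun t => (f t)^-1)%g @ F --> (a^-1)%g.
Proof. by move=> fa; apply: (cvg_comp _ _ fa); exact: invC. Qed.

Lemma close_near (x : G) : exists2 A : set G, nbhs x A & forall a b, A a -> A b -> U (a^-1 * b)%g.
Proof.
have c : (fun p : G * G => (p.1^-1 * p.2)%g) @ (x, x) --> (x^-1 * x : G)%g.
  apply: cvg_mulg; last exact: cvg_snd.
  by apply: cvg_invg; exact: cvg_fst.
rewrite mulVg in c.
have [[A B] [/= nA nB] AB] := c _ U1.
exists (A `&` B); first exact: filterI.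
by move=> a b [Aa _] [_ Bb]; apply: (AB (a, b)).
Qed.

(** Heine's theorem, with closeness in the group measured by [U]. *)
Lemma uniformly_close (E : pseudoMetricType R) (K : set E) (H : E -> G) :
  compact K -> {within K, continuous H} ->
  exists2 e : R, 0 < e & forall p q, K p -> K q -> ball p e q -> close U (H p) (H q).
Proof.
move=> /compact_near_coveringP cK /subspace_continuousP cH.
have [|e /= e0 he] := cK R (0^'+)%R
  (fun e p => K p -> forall q, K q -> ball p e q -> close U (H p) (H q)) _.
  move=> p Kp; have [A nA AU] := close_near (H p).
  have /nbhs_ballP[r /= r0 rA] := cH p Kp A nA.
  have r20 : 0 < r / 2 by rewrite divr_gt0.
  exists (ball p (r / 2), [set e | e < r / 2]) => /=.
    by split; [exact: nbhsx_ballx|exact: nbhs_right_lt].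
  move=> [p' e] /= [pp' er] Kp' q Kq p'q; apply: AU.
    by apply: (rA p') => //; apply: le_ball pp'; rewrite ler_pdivrMr// ler_peMr ?ler1n// ltW.
  by apply: (rA q) => //; apply: (ball_split pp'); apply: le_ball p'q; exact: ltW.
have e2 : 0 < e / 2 by rewrite divr_gt0.
exists (e / 2) => // p q Kp Kq pq; apply: (he (e / 2) _ e2 p Kp Kp q Kq pq).
by rewrite /= sub0r normrN gtr0_norm// ltr_pdivrMr// ltr_pMr// ltr1n.
Qed.

End Uniform.

Section Paths.
Variables (R : realType) (G : groupTopType) (K : groupType).
Hypothesis mulC : continuous (fun p : G * G => (p.1 * p.2)%g).
Hypothesis invC : continuous (fun x : G => (x^-1)%g).
Variables (U : set G) (phi : G -> K).
Hypothesis U1 : nbhs 1%g U.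
Hypothesis phiM : forall x y, U x -> U y -> U (x * y)%g -> phi (x * y)%g = (phi x * phi y)%g.

Local Notation path_prod := (path_prod phi).

Definition samples (T : Type) (gam : R -> T) (n i : nat) : T := gam (i%:R / n%:R).

(** The common value of the products over all sufficiently fine regular
    subdivisions, i.e. the endpoint of the lift of the path. *)
Definition holonomy (gam : R -> G) (v : K) : Prop :=
  exists N0 : nat, forall n, (N0 < n)%N -> path_prod (samples gam n) n = v.

(** Paths are defined on the whole line and stay constant outside the unit
    interval, so that [gcat] below needs no gluing. *)
Definition gpath (gam : R -> G) : Prop :=
  [/\ continuous gam, (forall t, t <= 0 -> gam t = gam 0) & (forall t, 1 <= t -> gam t = gam 1)].

Lemma frac_in_unit i n : (i <= n)%N -> (0 < n)%N -> (i%:R / n%:R : R) \in `[0, 1].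
Proof.
move=> i_n n0; rewrite in_itv /= divr_ge0//=.
by rewrite ler_pdivrMr ?ltr0n// mul1r ler_nat.
Qed.

Lemma holonomy_uniq gam v w : holonomy gam v -> holonomy gam w -> v = w.
Proof.
move=> [n hn] [m hm]; rewrite -(hn (maxn n m).+1) ?ltnS ?leq_maxl//.
by rewrite (hm (maxn n m).+1) ?ltnS ?leq_maxr.
Qed.

Lemma gpath_fine gam : gpath gam -> exists N0 : nat, forall s t : R, s \in `[0, 1] -> t \in `[0, 1] ->
  `|s - t| * N0%:R <= 1 -> close U (gam s) (gam t).
Proof.
move=> [cg _ _].
have [|e e0 he] := uniformly_close mulC invC U1 (@segment_compact R 0 1) (H := gam).
  exact: continuous_subspaceT.
have := archi_boundP (ltW (_ : 0 < e^-1)); rewrite invr_gt0 => /(_ e0).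
set N := Num.bound _ => eN; exists N => s t s01 t01 stN; apply: he => //.
rewrite /ball /= -(ltr_pM2r (x := N%:R)); last by apply: le_lt_trans eN; rewrite invr_ge0 ltW.
apply: le_lt_trans stN _; rewrite -(ltr_pM2l (x := e^-1)) ?invr_gt0//.
by rewrite mulr1 mulKf// gt_eqF.
Qed.

Lemma fine_close gam (N0 : nat) :
  (forall s t : R, s \in `[0, 1] -> t \in `[0, 1] -> `|s - t| * N0%:R <= 1 ->
    close U (gam s) (gam t)) ->
  forall n i j, (i <= n)%N -> (j <= n)%N -> (0 < n)%N -> (`|(i : int) - j|%N * N0 <= n)%N ->
    close U (samples gam n i) (samples gam n j).
Proof.
move=> fN n i j i_n j_n n0 ijN; apply: fN; rewrite ?frac_in_unit//.
rewrite -mulrBl normrM normfV normr_nat mulrAC ler_pdivrMr ?ltr0n// mul1r.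
have -> : `|i%:R - j%:R| = (`|(i : int) - j|%N)%:R :> R.
  by rewrite natr_absz intr_norm rmorphB.
by rewrite -natrM ler_nat.
Qed.

(** Two fine subdivisions, into n and m steps, have the common refinement into
    n * m steps. *)
Lemma holonomy_ex gam : gpath gam -> exists v, holonomy gam v.
Proof.
move=> /gpath_fine[N0 fN]; exists (path_prod (samples gam N0.+1) N0.+1).
have refine n m : (N0 < n)%N -> (0 < m)%N ->
    path_prod (samples gam (n * m)) (n * m) = path_prod (samples gam n) n.
  move=> Nn m0; rewrite (path_prod_refine (nbhs_singleton U1) phiM).
    apply: eq_path_prod => i i_n; rewrite /samples; congr (gam _).
    by rewrite !natrM -mulf_div divff ?mulr1// pnatr_eq0 -lt0n.
  move=> i a b i_n a_m b_m; apply: (fine_close fN); nia.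
exists N0 => n Nn; rewrite -(refine n N0.+1)// mulnC refine//.
exact: leq_ltn_trans Nn.
Qed.

(** Concatenation of [g] with the translate of [h] that starts where [g] ends. In
    a group it is a product of reparametrised paths: for t <= 1/2 the factor
    [h] rests at its origin, for t >= 1/2 the factor [g] rests at its end. *)
Definition gcat (g h : R -> G) (t : R) : G := (g (2 * t)%R * (h 0%R)^-1 * h (2 * t - 1)%R)%g.

Lemma gcatP g h : gpath g -> gpath h ->
  [/\ gpath (gcat g h), gcat g h 0 = g 0 & gcat g h 1 = (g 1%R * (h 0%R)^-1 * h 1%R)%g].
Proof.
move=> [cg g0 g1] [ch h0 h1].
have e0 t : t <= 0 -> gcat g h t = g 0.
  by move=> t0; rewrite /gcat (g0 (2 * t)) ?(h0 (2 * t - 1)) ?mulgVK//; lra.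
have e1 t : 1 <= t -> gcat g h t = (g 1%R * (h 0%R)^-1 * h 1%R)%g.
  by move=> t0; rewrite /gcat (g1 (2 * t)) ?(h1 (2 * t - 1))//; lra.
split; [split|exact: e0|exact: e1].
- move=> t; rewrite /gcat.
  have cM : (fun s : R => 2 * s) @ t --> 2 * t by apply: cvgM; [exact: cvg_cst|exact: cvg_id].
  apply: cvg_mulg => //.
    apply: cvg_mulg => //; last exact: cvg_cst.
    by apply: (cvg_comp _ _ cM); exact: cg.
  apply: (@cvg_comp _ _ _ (fun s : R => 2 * s - 1) h _ (nbhs (2 * t - 1))); last exact: ch.
  by apply: cvgB => //; exact: cvg_cst.
- by move=> t t0; rewrite !e0.
- by move=> t t1; rewrite !e1.
Qed.

Lemma holonomy_cat g h v w : gpath g -> gpath h -> holonomy g v -> holonomy h w ->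
  holonomy (gcat g h) (v * w)%g.
Proof.
move=> pg ph hv hw; have [pc _ _] := gcatP pg ph.
have [u [N hu]] := holonomy_ex pc; exists N => n Nn; rewrite hu//.
have [N1 {}hv] := hv; have [N2 {}hw] := hw.
pose m := (maxn N (maxn N1 N2)).+1.
have mN : (N < m)%N by rewrite ltnS leq_maxl.
have m1 : (N1 < m)%N by rewrite ltnS (leq_trans (leq_maxl _ N2))// leq_maxr.
have m2 : (N2 < m)%N by rewrite ltnS (leq_trans (leq_maxr N1 _))// leq_maxr.
rewrite -(hu (m + m)%N); last lia.
rewrite path_prod_cat -(hv m)// -(hw m)//.
have mp : 0 < m%:R :> R by rewrite ltr0n.
have m0 : (m%:R : R) != 0 by rewrite gt_eqF.
move: (m) mN m1 m2 mp m0 => {}m mN m1 m2 mp m0.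
have [_ _ g1] := pg; have [_ h0 _] := ph.
congr (_ * _)%g.
  apply: eq_path_prod => i i_m; rewrite /samples /gcat.
  have -> : 2 * (i%:R / (m + m)%:R) = i%:R / m%:R :> R.
    by rewrite natrD; field; rewrite m0 /=; apply: lt0r_neq0; lra.
  rewrite [h (_ - 1)]h0; first by rewrite mulgVK.
  by have := frac_in_unit i_m (leq_ltn_trans (leq0n _) mN); rewrite in_itv /=; lra.
rewrite -[RHS](path_prod_transl phi (g 1%R * (h 0%R)^-1)%g).
apply: eq_path_prod => i i_m; rewrite /samples /gcat.
have -> : 2 * ((m + i)%:R / (m + m)%:R) = 1 + i%:R / m%:R :> R.
  by rewrite !natrD; field; rewrite m0 /=; apply: lt0r_neq0; lra.
rewrite (g1 (1 + _)); first by rewrite [1 + _ - 1]addrC addKr.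
by have := frac_in_unit i_m (leq_ltn_trans (leq0n _) mN); rewrite in_itv /=; lra.
Qed.

Definition grev (g : R -> G) (t : R) : G := g (1 - t).

Lemma grevP g : gpath g -> gpath (grev g).
Proof.
move=> [cg g0 g1]; rewrite /grev; split.
- move=> t; apply: (@cvg_comp _ _ _ (fun s : R => 1 - s) g _ (nbhs (1 - t))); last exact: cg.
  by apply: cvgB; [exact: cvg_cst|exact: cvg_id].
- by move=> t t0; rewrite g1 ?subr0//; lra.
- by move=> t t0; rewrite g0 ?subrr//; lra.
Qed.

Lemma holonomy_rev g v : gpath g -> holonomy g v -> holonomy (grev g) (v^-1)%g.
Proof.
move=> pg [N1 hv]; have [N fN] := gpath_fine pg.
exists (maxn N1 N) => n; rewrite gtn_max => /andP[n1 nN].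
rewrite -(hv n)// -(path_prod_rev (nbhs_singleton U1) phiM).
  apply: eq_path_prod => i i_n; rewrite /samples /grev natrB//.
  by rewrite mulrBl divff// pnatr_eq0; lia.
by move=> i i_n; split; apply: (fine_close fN) => //; lia.
Qed.

(** If all increments lie in [U], already the trivial subdivision is fine. *)
Lemma holonomy_small g : gpath g -> (forall s t, close U (g s) (g t)) ->
  holonomy g (phi ((g 0%R)^-1 * g 1%R)%g).
Proof.
move=> pg cg; exists 0%N => n n0.
rewrite (path_prod_telescope (nbhs_singleton U1) phiM); last by move=> *; exact: cg.
by rewrite /samples mul0r divff// pnatr_eq0 -lt0n.
Qed.

Hypothesis G_sc : simply_connected R G.

(** A null-homotopy, sampled on a grid finer than its modulus of uniform
    closeness, is a grid to which [path_prod_grid] applies. *)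
Lemma holonomy_loop g v : gpath g -> g 0 = g 1 -> holonomy g v -> v = 1%g.
Proof.
move=> pg g01 hv; have [cg _ _] := pg; have [_ _ /(_ g)] := G_sc.
have wcg : {within `[0, 1], continuous g} by exact: continuous_subspaceT.
move=> /(_ wcg g01)[H [cH H0 H1 Hb]].
have [|e e0 he] := @uniformly_close R G mulC invC U U1 (R * R)%type
  (`[(0 : R), (1 : R)]%classic `*` `[(0 : R), (1 : R)]%classic) H _ cH.
  by apply: compact_setX; exact: segment_compact.
apply: (holonomy_uniq hv).
have := archi_boundP (ltW (_ : 0 < e^-1)); rewrite invr_gt0 => /(_ e0).
set N := Num.bound _ => eN; exists N => n Nn.
have n0 : (0 < n)%N by exact: leq_ltn_trans Nn.
have nR : 0 < n%:R :> R by rewrite ltr0n.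
(* neighbouring grid points are at distance 1 / n < e in both coordinates *)
have close_frac i j : (i <= j.+1)%N -> (j <= i.+1)%N -> ball (i%:R / n%:R : R) e (j%:R / n%:R).
  move=> ij ji; rewrite /ball /= -mulrBl normrM normfV normr_nat ltr_pdivrMr//.
  apply: (@le_lt_trans _ _ 1).
    rewrite ler_norml; have : (i%:R <= j.+1%:R :> R) by rewrite ler_nat.
    have : (j%:R <= i.+1%:R :> R) by rewrite ler_nat.
    rewrite -!natr1; lra.
  rewrite mulrC -ltr_pdivrMr// mul1r; apply: lt_trans eN _.
  by rewrite ltr_nat.
have := @path_prod_grid _ _ U phi (nbhs_singleton U1) phiM
  (fun i j => H (i%:R / n%:R, j%:R / n%:R)) n.
have H00 : H (0%:R / n%:R, 0%:R / n%:R) = g 0.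
  by rewrite mul0r; have [] := Hb 0 _; rewrite ?in_itv //= lexx ler01.
rewrite H00 => <-.
- by apply: eq_path_prod => i i_n; rewrite /samples mul0r H0// frac_in_unit.
- move=> i i' j j' i_n i'_n j_n j'_n *; apply: he; try by split; apply: frac_in_unit.
  by split; apply: close_frac.
- move=> i i_n; rewrite mul0r divff ?gt_eqF//.
  by apply: Hb; rewrite frac_in_unit.
- by move=> j j_n; rewrite divff ?gt_eqF// H1// frac_in_unit.
Qed.

Lemma holonomy_end g h v w : gpath g -> gpath h -> g 0 = h 0 -> g 1 = h 1 ->
  holonomy g v -> holonomy h w -> v = w.
Proof.
move=> pg ph e0 e1 hv hw; have pr := grevP ph.
have [pc c0 c1] := gcatP pg pr.
have := holonomy_loop pc _ (holonomy_cat pg pr hv (holonomy_rev ph hw)).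
rewrite c0 c1 /grev subr0 subrr e1 mulgV mul1g e0 => /(_ erefl) e.
by rewrite -[v](mulgVK w) e mul1g.
Qed.

Definition clamp (t : R) : R := Num.max 0 (Num.min 1 t).

Lemma clamp_continuous t : {for t, continuous clamp}.
Proof.
have ci : {for t, continuous (id : R -> R^o)} by exact: cvg_id.
have c1 : {for t, continuous (cst 1 : R -> R^o)} by exact: cst_continuous.
have c0 : {for t, continuous (cst 0 : R -> R^o)} by exact: cst_continuous.
exact: (continuous_max c0 (continuous_min c1 ci)).
Qed.

Lemma gpath_clamp (g : R -> G) : {within `[0, 1], continuous g} -> gpath (g \o clamp).
Proof.
move=> /subspace_continuousP cg.
have c01 t : `[0, 1]%classic (clamp t).
  by rewrite /= in_itv /= /clamp le_max lexx /= ge_max ler01 ge_min lexx.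
split.
- move=> t; rewrite /continuous_at /=.
  apply: (@cvg_comp _ _ _ clamp g _ (within `[0, 1] (nbhs (clamp t)))); last exact: cg.
  have cc := clamp_continuous (t := t).
  move=> A hA.
  have cA : nbhs t (clamp @^-1` [set s | `[0, 1]%classic s -> A s]) by exact: cc _ hA.
  by apply: filterS cA => s; apply; exact: c01.
- move=> t t0; rewrite /= /clamp; congr g.
  by rewrite !min_r ?ler01 ?(le_trans t0)// !max_l.
- by move=> t t1; rewrite /= /clamp !min_l.
Qed.

Lemma sc_gpath x : exists2 g : R -> G, gpath g & g 0 = 1%g /\ g 1 = x.
Proof.
have [_ /(_ 1%g x)[g [cg g0 g1]] _] := G_sc.
exists (g \o clamp); first exact: gpath_clamp.
by rewrite /= /clamp min_r// max_l// min_l// max_r.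
Qed.

(** The value at x is the holonomy of any path from 1 to x. It does not depend
    on the path because loops have trivial holonomy, and concatenating paths
    multiplies holonomies. The second property identifies the extension with
    [phi] at the end of a path without large increments. *)
Theorem extend_local_hom : exists2 f : G -> K,
  {morph f : x y / (x * y)%g} &
  forall g, gpath g -> g 0 = 1%g -> (forall s t, close U (g s) (g t)) -> f (g 1) = phi (g 1).
Proof.
have ex x : exists v, exists2 g : R -> G, gpath g & [/\ g 0 = 1%g, g 1 = x & holonomy g v].
  have [g pg [g0 g1]] := sc_gpath x; have [v hv] := holonomy_ex pg.
  by exists v, g.
have [f hf] := choice ex; exists f => [x y|g pg g0 cg].
  (* the concatenated path ends at x * y since h starts at 1 *)
  have [g pg [g0 g1 hg]] := hf x; have [h ph [h0 h1 hh]] := hf y.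
  have [k pk [k0 k1 hk]] := hf (x * y)%g.
  have [pc c0 c1] := gcatP pg ph.
  apply: holonomy_end pk pc _ _ hk (holonomy_cat pg ph hg hh); first by rewrite k0 c0.
  by rewrite k1 c1 g1 h0 h1 invg1 mulg1.
have [h ph [h0 h1 hh]] := hf (g 1).
have := holonomy_small pg cg; rewrite g0 invg1 mul1g.
by apply: holonomy_end ph pg _ _ hh; rewrite ?h0 ?h1 ?g0.
Qed.

(** A group in which every point is joined to 1 by a path is generated by each
    neighbourhood of 1: cut the path into small increments. *)
Theorem homs_eq_near1 (f f' : G -> K) :
  {morph f : x y / (x * y)%g} -> {morph f' : x y / (x * y)%g} ->
  (forall x, U x -> f x = f' x) -> f = f'.
Proof.
move=> fM f'M ff'; apply/funext => x.
have [g pg [g0 g1]] := sc_gpath x; have [N fN] := gpath_fine pg.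
have mor1 (h : G -> K) : {morph h : x y / (x * y)%g} -> h 1%g = 1%g.
  by move=> hM; have := hM 1%g 1%g; rewrite mulg1 => e; rewrite -[LHS](mulKg (h 1%g)) -e mulVg.
suff s i : (i <= N.+1)%N -> f (samples g N.+1 i) = f' (samples g N.+1 i).
  by have := s _ (leqnn _); rewrite /samples divff ?g1// pnatr_eq0.
elim: i => [_|i IH i_n].
  by rewrite /samples mul0r g0 !mor1.
rewrite -[samples g N.+1 i.+1](mulVKg (samples g N.+1 i)) fM f'M IH; last exact: ltnW.
congr (_ * _)%g; apply: ff'; apply: (fine_close fN) => //; lia.
Qed.

End Paths.

(** * GL(V) in coordinates *)

Section GLbasic.
Variables (R : realType) (V : vectType R[i]).
Local Notation n := (\dim {:V}).
Local Notation B := (vbasis {:V}).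

(** Composition turns into the reverse product of matrices, which act on row
    vectors. *)
Definition endo_mx (f : 'End(V)) : 'M[R[i]]_n := mxof B B f.
Definition gl_mx (A : GL V) : 'M[R[i]]_n := endo_mx (val A).

Lemma endo_mxK : cancel endo_mx (hommx B B).
Proof. by apply: mxofK; exact: vbasisP. Qed.

Lemma endo_mx1 : endo_mx \1%VF = 1%:M.
Proof.
apply/row_matrixP => i; rewrite !rowE mul_mxof lfunE /= vecofK ?mulmx1//.
exact: vbasisP.
Qed.

Lemma endo_mxM f g : endo_mx (f \o g)%VF = endo_mx g *m endo_mx f.
Proof. by apply: mxof_comp; exact: vbasisP. Qed.

Lemma gl_mx1 : gl_mx 1%g = 1%:M. Proof. exact: endo_mx1. Qed.

Lemma gl_mxM A C : gl_mx (A * C)%g = gl_mx C *m gl_mx A. Proof. exact: endo_mxM. Qed.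

Lemma gl_mx_inj : injective gl_mx.
Proof. by move=> A C /(can_inj endo_mxK)/val_inj. Qed.

Lemma gl_mx_unit A : gl_mx A \in unitmx.
Proof.
have : gl_mx (A * A^-1)%g = 1%:M by rewrite mulgV gl_mx1.
by rewrite gl_mxM => /mulmx1_unit[].
Qed.

Lemma gl_det_neq0 A : \det (gl_mx A) != 0.
Proof. by have := gl_mx_unit A; rewrite unitmxE unitfE. Qed.

(** The inverse matrix provides a left inverse of [f]. *)
Lemma lker0_endo_mx (f : 'End(V)) : \det (endo_mx f) != 0 -> lker f == 0%VS.
Proof.
rewrite -unitfE -unitmxE => fU; apply/lker0P.
apply: (can_inj (g := hommx B B (invmx (endo_mx f)))) => x.
rewrite -comp_lfunE; have -> : (hommx B B (invmx (endo_mx f)) \o f)%VF = \1%VF.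
  apply: (can_inj endo_mxK); rewrite endo_mxM endo_mx1.
  by rewrite /endo_mx hommxK ?mulmxV// ; exact: vbasisP.
by rewrite lfunE.
Qed.

Local Notation d := (gl_dim V).
Local Notation BE := (vbasis {:'End(V)}).

(** The endomorphism with given coordinates. Unlike [gl_of_coord] it is linear on
    the whole model space, which makes its matrix entries smooth everywhere. *)
Definition model_endo (z : gl_model V) : 'End(V) :=
  \sum_(j < d) (z.1 ord0 j +i* z.2 ord0 j)%C *: BE`_j.
Definition model_mx (z : gl_model V) : 'M[R[i]]_n := endo_mx (model_endo z).

Lemma gl_coordE (A : GL V) : model_endo (gl_coord A) = val A.
Proof.
rewrite [RHS](coord_vbasis (memvf _)); apply: eq_bigr => j _; rewrite !mxE.
by case: (coord _ _ _).
Qed.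

Lemma model_mx_coord (A : GL V) : model_mx (gl_coord A) = gl_mx A.
Proof. by rewrite /model_mx gl_coordE. Qed.

Lemma gl_of_coordK (A : GL V) : gl_of_coord (gl_coord A) = A.
Proof. by rewrite -[LHS]/(insubd (gl_one V) (model_endo (gl_coord A))) gl_coordE valKd. Qed.

Lemma gl_coordK (z : gl_model V) : \det (model_mx z) != 0 -> gl_coord (gl_of_coord z) = z.
Proof.
move=> z0; rewrite /gl_coord -[gl_of_coord z]/(insubd (gl_one V) (model_endo z)).
rewrite insubdK; last exact: lker0_endo_mx.
case: z z0 => z1 z2 _; rewrite /model_endo.
by congr pair; apply/rowP => j; rewrite mxE coord_sum_free ?(basis_free (vbasisP _)).
Qed.

Lemma cplx_smooth_model_mx (O : set (gl_model V)) i j :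
  open O -> cplx (smooth_on O) (fun z => model_mx z i j).
Proof.
move=> oO; have PA := smooth_fun_algebra oO.
apply: (eq_cplx (g := fun z : gl_model V =>
  \sum_(k < d) (z.1 ord0 k +i* z.2 ord0 k)%C * endo_mx (BE`_k) i j)).
  move=> z; rewrite /model_mx /model_endo /endo_mx linear_sum summxE.
  by apply: eq_bigr => k _; rewrite linearZ /= [in RHS]mxE.
apply: (cplx_sum PA) => k _; apply: (cplxM PA); last exact: (cplx_cst PA).
split; first exact: (@smooth_pair_coord R d d O (inl k)).
exact: (@smooth_pair_coord R d d O (inr k)).
Qed.

Lemma gl_coord_image (U : set (GL V)) :
  @gl_coord R V @` U = [set z | \det (model_mx z) != 0 /\ U (gl_of_coord z)].
Proof.
apply/seteqP; split=> [z [A UA <-]|z [z0 Uz]] /=.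
  by rewrite model_mx_coord gl_of_coordK; split=> //; exact: gl_det_neq0.
by exists (gl_of_coord z) => //; rewrite gl_coordK.
Qed.

(** The image of GL(V) is the complement of the zeros of the determinant. *)
Lemma gl_image_open (U : set (GL V)) : open U -> open (@gl_coord R V @` U).
Proof.
case=> O oO OU; rewrite gl_coord_image.
have -> : [set z | \det (model_mx z) != 0 /\ U (gl_of_coord z)] =
    [set z | O z /\ \det (model_mx z) != 0].
  apply/seteqP; split=> z /= [h1 h2].
    by move: h2; rewrite -OU /= gl_coordK.
  by split=> //; rewrite -OU /= gl_coordK.
apply: cplx_open_neq0 => // x _.
have PA := @smooth_fun_algebra R (gl_model V) setT openT.
apply: (@cplx_smooth_continuous _ _ setT) => //; apply: (cplx_det PA) => i j.
exact/cplx_smooth_model_mx/openT.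
Qed.

Lemma gl_coord_continuous : continuous (@gl_coord R V).
Proof. exact: initial_continuous. Qed.

Lemma gl_sheafE (U : set (GL V)) f :
  gl_sheaf U f <-> smooth_on (@gl_coord R V @` U) (f \o @gl_of_coord R V).
Proof.
split=> [/(_ (gl_chart V) erefl)|h c ->]; rewrite /= setTI//.
Qed.

End GLbasic.

(** * A determinant-one section of GL(V) -> PGL(V) near the identity *)

Section LocalSection.
Variables (R : realType) (V : vectType R[i]).
Local Notation n := (\dim {:V}).
Variable i0 : 'I_n.

Let n0 : (0 < n)%N. Proof. exact: leq_ltn_trans (leq0n i0) (ltn_ord i0). Qed.

(** The determinant of [M] rescaled to have a corner entry equal to 1; it is
    invariant under scaling, so it descends to PGL(V). *)
Definition ratio_det (M : 'M[R[i]]_n) : R[i] := \det M / M i0 i0 ^+ n.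
(** The scalar, homogeneous of degree one in [M], by which [M] has to be divided to
    acquire determinant 1: its n-th power is the determinant. *)
Definition normalizer (M : 'M[R[i]]_n) : R[i] := M i0 i0 * croot n (ratio_det M).
(** The scale-invariant domain on which the corner entry can be normalised and
    the principal root of [ratio_det] is smooth; it contains the identity. *)
Definition big_cell (M : 'M[R[i]]_n) : Prop := M i0 i0 != 0 /\ 0 < complex.Re (ratio_det M).

Definition gl_scale (a : R[i]) (A : GL V) : GL V := insubd A (a *: val A).
Definition gl_normalize (A : GL V) : GL V := gl_scale (normalizer (gl_mx A))^-1 A.

Lemma gl_mx_scale a A : a != 0 -> gl_mx (gl_scale a A) = a *: gl_mx A.
Proof.
move=> a0; have lk : lker (a *: val A) == 0%VS.
  apply: lker0_endo_mx; rewrite /endo_mx linearZ /= detZ mulf_neq0 ?expf_neq0//.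
  exact: gl_det_neq0.
rewrite /gl_mx /gl_scale insubdK; last exact: lk.
by rewrite /endo_mx linearZ.
Qed.

Lemma ratio_detZ a M : a != 0 -> ratio_det (a *: M) = ratio_det M.
Proof.
by move=> a0; rewrite /ratio_det detZ mxE exprMn invfM mulrACA divff ?mul1r// expf_neq0.
Qed.

Lemma normalizerZ a M : a != 0 -> normalizer (a *: M) = a * normalizer M.
Proof. by move=> a0; rewrite /normalizer ratio_detZ// mxE mulrA. Qed.

Lemma big_cellZ a M : a != 0 -> big_cell (a *: M) <-> big_cell M.
Proof. by move=> a0; rewrite /big_cell ratio_detZ// mxE mulf_eq0 (negPf a0). Qed.

Lemma big_cell1 : big_cell 1%:M.
Proof. by rewrite /big_cell /ratio_det det1 mxE eqxx expr1n divr1 oner_neq0 /= ltr01. Qed.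

Lemma normalizer1 : normalizer 1%:M = 1.
Proof. by rewrite /normalizer /ratio_det det1 mxE eqxx expr1n divr1 croot1 mulr1. Qed.

Lemma croot_ratio_neq0 M : big_cell M -> croot n (ratio_det M) != 0.
Proof.
move=> [_ d0]; have := crootK n0 d0; apply: contra_eq_neq => ->.
by rewrite expr0n -[n]prednK//= ; apply: contraTneq d0 => <-; rewrite ltxx.
Qed.

Lemma normalizer_neq0 M : big_cell M -> normalizer M != 0.
Proof. by move=> bM; rewrite mulf_neq0 ?croot_ratio_neq0//; case: bM. Qed.

Lemma gl_mx_normalize A : big_cell (gl_mx A) ->
  gl_mx (gl_normalize A) = (normalizer (gl_mx A))^-1 *: gl_mx A.
Proof. by move=> bA; rewrite gl_mx_scale// invr_eq0 normalizer_neq0. Qed.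

Lemma det_normalize A : big_cell (gl_mx A) -> \det (gl_mx (gl_normalize A)) = 1.
Proof.
move=> bA; have [e0 d0] := bA; rewrite gl_mx_normalize// detZ.
rewrite exprVn exprMn crootK// mulrC.
rewrite /ratio_det mulrCA divff ?expf_neq0// mulr1 divff//.
exact: gl_det_neq0.
Qed.

Lemma normalize_corner_neq0 A : big_cell (gl_mx A) -> gl_mx (gl_normalize A) i0 i0 != 0.
Proof.
by move=> bA; have [e0 _] := bA; rewrite gl_mx_normalize// mxE mulf_neq0// invr_eq0 normalizer_neq0.
Qed.

Lemma pgl_pi_mx (A C : GL V) : pgl_pi A = pgl_pi C <-> exists2 a, a != 0 & gl_mx A = a *: gl_mx C.
Proof.
rewrite pgl_piP; split=> -[a a0 e]; exists a => //.
  by rewrite /gl_mx e /endo_mx linearZ.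
by apply: (can_inj (@endo_mxK _ _)); rewrite {2}/endo_mx linearZ.
Qed.

Lemma pgl_pi_normalize A : big_cell (gl_mx A) -> pgl_pi (gl_normalize A) = pgl_pi A.
Proof.
move=> bA; apply/pgl_pi_mx; exists (normalizer (gl_mx A))^-1; last exact: gl_mx_normalize.
by rewrite invr_eq0 normalizer_neq0.
Qed.

Lemma normalize_pi A C : big_cell (gl_mx A) -> pgl_pi C = pgl_pi A -> gl_normalize C = gl_normalize A.
Proof.
move=> bA /pgl_pi_mx[a a0 e]; apply: gl_mx_inj.
rewrite !gl_mx_normalize//; last by rewrite e big_cellZ.
by rewrite e normalizerZ// invfM scalerA mulrAC mulVf// mul1r.
Qed.

(** A local right inverse of the projection with values of determinant 1.
    Taking determinant 1 leaves only the n-th roots of unity as ambiguity, and this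
    is what makes the section multiplicative near 1. *)
Definition pgl_section (p : PGL V) : GL V := gl_normalize (repr p).
Definition pgl_cell : set (PGL V) := [set p | big_cell (gl_mx (repr p))].

Lemma pgl_cellE A : pgl_cell (pgl_pi A) <-> big_cell (gl_mx A).
Proof.
rewrite /pgl_cell /=; have /pgl_pi_mx[a a0 ->] : pgl_pi (repr (pgl_pi A)) = pgl_pi A.
  exact: pgl_reprK.
exact: big_cellZ.
Qed.

Lemma pgl_cell1 : pgl_cell 1%g.
Proof. by apply/pgl_cellE; rewrite gl_mx1; exact: big_cell1. Qed.

Lemma pgl_section_pi A : big_cell (gl_mx A) -> pgl_section (pgl_pi A) = gl_normalize A.
Proof. by move=> bA; apply: normalize_pi => //; exact: pgl_reprK. Qed.

Lemma pgl_sectionK p : pgl_cell p -> pgl_pi (pgl_section p) = p.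
Proof. by move=> cp; rewrite pgl_pi_normalize// pgl_reprK. Qed.

Lemma pgl_section1 : pgl_section 1%g = 1%g.
Proof.
have b1 : big_cell (gl_mx (1%g : GL V)) by rewrite gl_mx1; exact: big_cell1.
rewrite -[1%g in LHS]/(pgl_pi 1%g) pgl_section_pi//; apply: gl_mx_inj.
by rewrite gl_mx_normalize// gl_mx1 normalizer1 invr1 scale1r.
Qed.

(** The two sides differ by a scalar [z] with [z ^+ n = 1]. If [z] is not 1 then
    the sum of its first n powers vanishes; the positivity hypothesis, which holds by
    continuity near the identity, excludes this. *)
Lemma pgl_section_mul p q :
  let z := gl_mx (pgl_section p * pgl_section q)%g i0 i0 / gl_mx (pgl_section (p * q)%g) i0 i0 in
  pgl_cell p -> pgl_cell q -> pgl_cell (p * q)%g ->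
  0 < complex.Re (\sum_(k < n) z ^+ k) ->
  pgl_section (p * q)%g = (pgl_section p * pgl_section q)%g.
Proof.
move=> z cp cq cpq; have /pgl_pi_mx[a a0 e] :
    pgl_pi (pgl_section p * pgl_section q)%g = pgl_pi (pgl_section (p * q)%g).
  by rewrite pgl_piM !pgl_sectionK.
have -> : z = a.
  by rewrite /z e mxE mulfK//; exact: normalize_corner_neq0.
have an : a ^+ n = 1.
  have := congr1 (fun M => \det M) e; rewrite gl_mxM det_mulmx detZ !det_normalize//.
  by rewrite !mulr1 => ->.
have [a1|a1] := eqVneq a 1; first by move=> _; apply: gl_mx_inj; rewrite e a1 scale1r.
have /eqP := subrX1 a n; rewrite an subrr eq_sym mulf_eq0 subr_eq0 (negPf a1) /= => /eqP->.
by rewrite ltxx.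
Qed.

Definition model_cell : set (gl_model V) :=
  [set z | \det (model_mx z) != 0 /\ big_cell (model_mx z)].

Lemma model_cellE : model_cell = @gl_coord R V @` [set A | big_cell (gl_mx A)].
Proof.
rewrite gl_coord_image; apply/seteqP; split=> z /= [z0 bz]; split=> //.
  by rewrite -model_mx_coord gl_coordK.
by rewrite -[z]gl_coordK// model_mx_coord.
Qed.

Lemma smooth_ratio_det (O : set (gl_model V)) : open O ->
  (forall z, O z -> model_mx z i0 i0 != 0) ->
  cplx (smooth_on O) (fun z => ratio_det (model_mx z)).
Proof.
move=> oO e0; have PA := smooth_fun_algebra oO.
apply: (cplxM PA); first by apply: (cplx_det PA) => i j; exact: cplx_smooth_model_mx.
apply: (cplxV PA (D := O)); first exact: smooth_inv_closed.
  by apply: (cplxX PA); exact: cplx_smooth_model_mx.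
by move=> z /e0; exact: expf_neq0.
Qed.

Lemma model_cell_open : open model_cell.
Proof.
have o1 : open [set z : gl_model V | setT z /\ \det (model_mx z) != 0].
  apply: cplx_open_neq0; first exact: openT.
  move=> z _; apply: (@cplx_smooth_continuous _ _ setT) => //.
  by apply: (cplx_det (smooth_fun_algebra openT)) => i j; exact/cplx_smooth_model_mx/openT.
have o2 := cplx_open_neq0 (g := fun z : gl_model V => model_mx z i0 i0) o1.
have {}o2 := o2 (fun z _ => cplx_smooth_continuous (cplx_smooth_model_mx i0 i0 openT) I).
have [s2 _] := smooth_ratio_det o2 (fun z h => h.2).
have := open_positive o2 (fun z => smooth_continuous s2).
congr open; apply/seteqP; split=> z /=.
  by move=> [[[_ ?] ?] ?].
by move=> [? [? ?]].
Qed.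

(** A function on PGL(V) is smooth if its pullback to GL(V) is, and the pullback of
    the section is division by [normalizer]. *)
Lemma pgl_section_smooth i j : cplx (@pgl_sheaf R V pgl_cell) (fun p => gl_mx (pgl_section p) i j).
Proof.
have oc := model_cell_open; have PA := smooth_fun_algebra oc.
have sn : cplx (smooth_on model_cell) (fun z => (normalizer (model_mx z))^-1 * model_mx z i j).
  apply: (cplxM PA); last exact: cplx_smooth_model_mx.
  apply: (cplxV PA (D := model_cell)); first exact: smooth_inv_closed.
    apply: (cplxM PA); first exact: cplx_smooth_model_mx.
    apply: smooth_croot => //; last by move=> z [_ []].
    by apply: smooth_ratio_det => // z [_ []].
  by move=> z [_]; exact: normalizer_neq0.
have pc : @pgl_pi R V @^-1` pgl_cell = [set A | big_cell (gl_mx A)].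
  by apply/seteqP; split=> A /= h; apply/pgl_cellE.
have {}sn : cplx (smooth_on model_cell) (fun z => gl_mx (pgl_section (pgl_pi (gl_of_coord z))) i j).
  apply: cplx_smooth_congr sn => // z [z0 bz].
  have bz' : big_cell (gl_mx (gl_of_coord z)) by rewrite -model_mx_coord gl_coordK.
  by rewrite pgl_section_pi// gl_mx_normalize// [in RHS]mxE -model_mx_coord gl_coordK.
have [s1 s2] := sn.
by split; rewrite /pgl_sheaf /= pc; apply/gl_sheafE; rewrite -model_cellE.
Qed.

Lemma pgl_cell_open : open pgl_cell.
Proof.
suff : open (@pgl_pi R V @^-1` pgl_cell) by [].
have -> : @pgl_pi R V @^-1` pgl_cell = @gl_coord R V @^-1` model_cell.
  apply/seteqP; split=> A /=.
    by rewrite model_cellE => /pgl_cellE bA; exists A.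
  rewrite model_cellE => -[C bC /(congr1 (@gl_of_coord R V))].
  by rewrite !gl_of_coordK => <-; apply/pgl_cellE.
by apply: open_comp model_cell_open => A _; exact: gl_coord_continuous.
Qed.

End LocalSection.

Section IntoGL.
Variables (R : realType) (V : vectType R[i]).
Local Notation d := (gl_dim V).
Local Notation BE := (vbasis {:'End(V)}).

(** The coordinates in the basis of End(V) that define the smooth structure are
    complex linear in the matrix entries. *)
Lemma gl_coord_entries : exists c : 'I_d -> 'M[R[i]]_(\dim {:V}), forall (A : GL V) k,
  pair_coord (gl_coord A) (inl k) = complex.Re (\sum_i \sum_j gl_mx A i j * c k i j) /\
  pair_coord (gl_coord A) (inr k) = complex.Im (\sum_i \sum_j gl_mx A i j * c k i j).
Proof.
exists (fun k => \matrix_(i, j) coord BE k (hommx (vbasis {:V}) (vbasis {:V}) (delta_mx i j))) => A k.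
suff <- : coord BE k (val A) = \sum_i \sum_j gl_mx A i j * (\matrix_(i, j)
    coord BE k (hommx (vbasis {:V}) (vbasis {:V}) (delta_mx i j))) i j.
  by rewrite /= !mxE.
rewrite -[val A]endo_mxK -/(gl_mx A) {1}[gl_mx A]matrix_sum_delta.
rewrite !linear_sum; apply: eq_bigr => i _; rewrite !linear_sum; apply: eq_bigr => j _.
by rewrite mxE !linearZ.
Qed.

End IntoGL.

(** * Sheaves of smooth functions on manifolds *)

Section Sheaf.
Variables (R : realType) (T : topologicalType) (m : nat).
Variables (A : set (chart T 'rV[R]_m)) (HA : smooth_atlas A).
Local Notation E := 'rV[R]_m.
Local Notation sheaf := (@atlas_sheaf R T E A).

Lemma continuous_on_open (S S' : topologicalType) (O : set S) (f : S -> S') x :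
  open O -> {within O, continuous f} -> O x -> {for x, continuous f}.
Proof.
move=> oO /subspace_continuousP cf Ox; have := cf x Ox.
by rewrite within_interior//; exact: open_nbhs_nbhs.
Qed.

Lemma chart_image_open c U : A c -> open U -> open (c @` (chart_dom c `&` U)).
Proof.
have [+ _ _] := HA => /[apply] -[od oi cK cc ci] oU.
have -> : c @` (chart_dom c `&` U) = (c @` chart_dom c) `&` (chart_inv c) @^-1` U.
  apply/seteqP; split=> p /=.
    by move=> [x [dx Ux] <-]; split; [exists x|rewrite cK].
  by move=> [[x dx <-] Ux]; exists x => //; split=> //; move: Ux; rewrite cK.
by apply: open_setI_preimage => // x; exact: continuous_on_open ci.
Qed.

Lemma chart_continuous c x : A c -> chart_dom c x -> {for x, continuous c}.
Proof.
by have [+ _ _] := HA => /[apply] -[od oi cK cc ci] dx; exact: continuous_on_open cc dx.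
Qed.

Lemma chart_inv_continuous c x : A c -> chart_dom c x -> {for c x, continuous (chart_inv c)}.
Proof.
have [+ _ _] := HA => /[apply] -[od oi cK cc ci] dx; apply: continuous_on_open ci _ => //.
by exists x.
Qed.

Lemma chart_invK c x : A c -> chart_dom c x -> chart_inv c (c x) = x.
Proof. by have [+ _ _] := HA => /[apply] -[od oi cK cc ci]; exact: cK. Qed.

Lemma chart_at x : exists2 c, A c & chart_dom c x.
Proof. by have [_ + _] := HA; exact. Qed.

Lemma sheaf_algebra U : open U -> fun_algebra (sheaf U).
Proof.
move=> oU; split=> [a c Ac|f g sf sg c Ac|f g sf sg c Ac];
  have [PC PD PM] := smooth_fun_algebra (chart_image_open Ac oU).
- exact: PC.
- exact: PD _ _ (sf c Ac) (sg c Ac).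
- exact: PM _ _ (sf c Ac) (sg c Ac).
Qed.

Lemma sheaf_inv_closed U : open U -> inv_closed U (sheaf U).
Proof.
move=> oU f sf f0 c Ac; apply: (smooth_inv_closed (chart_image_open Ac oU)); first exact: sf.
by move=> p /= [x [dx Ux] <-]; rewrite (chart_invK Ac dx); exact: f0.
Qed.

Lemma sheaf_congr U f g : open U -> (forall x, U x -> f x = g x) -> sheaf U f -> sheaf U g.
Proof.
move=> oU fg sf c Ac; apply: smooth_on_congr (sf c Ac); first exact: chart_image_open.
by move=> p /= [x [dx Ux] <-]; rewrite (chart_invK Ac dx); exact: fg.
Qed.

Lemma sheaf_sub U W f : W `<=` U -> sheaf U f -> sheaf W f.
Proof.
move=> WU sf c Ac; apply: smooth_on_sub (sf c Ac).
by move=> p /= [x [dx /WU Ux] <-]; exists x.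
Qed.

Lemma sheaf_local U f : (forall x, U x -> exists2 W : set T, W x & sheaf W f) -> sheaf U f.
Proof.
move=> h c Ac; apply: smooth_on_local => p /= [x [dx Ux] <-].
by have [W Wx sW] := h x Ux; exists (c @` (chart_dom c `&` W)); [exists x|exact: sW].
Qed.

Lemma sheaf_continuous U f x : open U -> sheaf U f -> U x -> {for x, continuous f}.
Proof.
move=> oU sf Ux; have [c Ac dx] := chart_at x.
have [od _ _ _ _] : is_chart c by have [+ _ _] := HA; apply.
have cf : {for x, continuous ((f \o chart_inv c) \o c)}.
  apply: continuous_comp; first exact: chart_continuous.
  by apply: smooth_continuous (sf c Ac) _; exists x.
have := cf; rewrite /prop_for /continuous_at /= (chart_invK Ac dx); apply: cvg_trans.
apply: near_eq_cvg; apply: filterS (near_open od dx) => y dy /=.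
by rewrite (chart_invK Ac dy).
Qed.

Lemma cplx_sheaf_congr U (g h : T -> R[i]) : open U -> (forall x, U x -> g x = h x) ->
  cplx (sheaf U) g -> cplx (sheaf U) h.
Proof.
by move=> oU gh [s1 s2]; split; [apply: sheaf_congr s1|apply: sheaf_congr s2] => // x /gh ->.
Qed.

Lemma cplx_sheaf_local U (g : T -> R[i]) :
  (forall x, U x -> exists2 W : set T, W x & cplx (sheaf W) g) -> cplx (sheaf U) g.
Proof. by move=> h; split; apply: sheaf_local => x /h[W Wx []]; exists W. Qed.

Lemma cplx_sheaf_continuous U (g : T -> R[i]) x : open U -> cplx (sheaf U) g -> U x ->
  cplx (fun f : T -> R^o => {for x, continuous f}) g.
Proof.
move=> oU [s1 s2] Ux.
by split; [exact: sheaf_continuous s1 Ux|exact: sheaf_continuous s2 Ux].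
Qed.

(** Restricting a smooth function on the product to a slice is composing it, in
    charts, with an affine map. *)
Lemma sheaf_slice W (F : T * T -> R^o) (a : T) : open W ->
  atlas_sheaf (prod_atlas A A) W F -> sheaf [set y | W (a, y)] (fun y => F (a, y)).
Proof.
move=> oW sF c Ac; have [d Ad da] := chart_at a.
have oWa : open [set y | W (a, y)].
  have := open_comp (f := fun y : T => (a, y)) (D := W) _ oW; apply=> y _.
  by apply: cvg_pair; [exact: cvg_cst|exact: cvg_id].
have {}sF := sF (prod_chart d c) (ex_intro _ d (ex_intro _ c (And3 Ad Ac erefl))).
have -> : (fun y => F (a, y)) \o chart_inv c =
    (F \o chart_inv (prod_chart d c)) \o (fun q => (d a, q)).
  by apply/funext => q /=; rewrite chart_invK.
apply: (@smooth_on_comp R _ ('rV[R]_m * 'rV[R]_m)%type _ (@pair_frame R m m) _ _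
  (fun k q => pair_coord (d a, q) k) (fun q => (d a, q)) _ _ _ _ _ sF).
- exact: chart_image_open.
- by move=> q _; exact: pair_frameE.
- by move=> q /= [y [dy Wy] <-]; exists (a, y).
- by move=> -[j|j]; [move=> k; exact: Ck_on_cst|exact: smooth_row_coord].
Qed.

Variable V : vectType R[i].

(** In coordinates, a smooth function on GL(V) is composed with the real and
    imaginary parts of linear combinations of the matrix entries of [h]. *)
Lemma smooth_into_GL (h : T -> GL V) :
  (forall i j, cplx (sheaf setT) (fun x => gl_mx (h x) i j)) -> smooth_map sheaf (@gl_sheaf R V) h.
Proof.
move=> sh; have [cf cfE] := gl_coord_entries V.
have sc k : sheaf setT (fun x => pair_coord (gl_coord (h x)) k).
  have PA := sheaf_algebra openT.
  have s j : cplx (sheaf setT) (fun x => \sum_i0 \sum_i1 gl_mx (h x) i0 i1 * cf j i0 i1).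
    apply: (cplx_sum PA) => i0 _; apply: (cplx_sum PA) => i1 _.
    by apply: (cplxM PA); [exact: sh|exact: (cplx_cst PA)].
  case: k => j; have [s1 s2] := s j.
    by apply: sheaf_congr s1; [exact: openT|move=> x _; have [-> _] := cfE (h x) j].
  by apply: sheaf_congr s2; [exact: openT|move=> x _; have [_ ->] := cfE (h x) j].
have ch : continuous h.
  apply: continuous_comp_initial => x.
  suff : {for x, continuous (@gl_coord R V \o h)} by [].
  have -> : @gl_coord R V \o h = \sum_k (fun y => pair_coord (gl_coord (h y)) k *: @pair_frame R _ _ k).
    by apply/funext => y; rewrite fct_sumE /=; exact: pair_frameE.
  elim/big_ind : _ => [|f g cf' cg'|k _].
  - exact: cst_continuous.
  - exact: continuousD.
  - by apply: continuousZr_tmp; exact: sheaf_continuous openT (sc k) I.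
split=> // U f oU sf c Ac; move/gl_sheafE : sf => sf.
have ohU : open (h @^-1` U) by apply: open_comp oU => x _; exact: ch.
have -> : (f \o h) \o chart_inv c = (f \o @gl_of_coord R V) \o (@gl_coord R V \o h \o chart_inv c).
  by apply/funext => p /=; rewrite gl_of_coordK.
apply: (@smooth_on_comp R _ (gl_model V) _ (@pair_frame R _ _) _ _
  (fun k p => pair_coord (gl_coord (h (chart_inv c p))) k) _ _ _ _ _ _ sf).
- exact: chart_image_open.
- by move=> p _; exact: pair_frameE.
- by move=> p /= [x [dx Ux] <-]; rewrite chart_invK//; exists (h x).
- move=> k; apply: smooth_on_sub (sc k c Ac).
  by move=> p /= [x [dx Ux] <-]; exists x.
Qed.

End Sheaf.

(** * Existence of the lift *)

Section LieBasics.
Variables (R : realType) (G : lieGroup R).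

Lemma lie_mul_continuous : continuous (fun p : G * G => (p.1 * p.2)%g).
Proof. by have [] := lie_mulP G. Qed.

Lemma lie_inv_continuous : continuous (fun x : G => (x^-1)%g).
Proof. by have [] := lie_invP G. Qed.

Lemma ltrans_open (U : set G) (a : G) : open U -> open [set y : G | U (a * y)%g].
Proof.
move=> oU; apply: (open_comp (f := fun y : G => (a * y)%g)) oU => y _.
have ca : (fun=> a) @ y --> a by exact: cvg_cst.
have ci : (id : G -> G) @ y --> y by exact: cvg_id.
exact (@cvg_mulg G (@lie_mul_continuous) G (nbhs y) _ (fun=> a) id a y ca ci).
Qed.

Lemma mul_sheaf (U : set G) f : open U -> lie_sheaf U f ->
  atlas_sheaf (prod_atlas (@lie_atlas R G) (@lie_atlas R G)) [set p : G * G | U (p.1 * p.2)%g]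
    (fun p : G * G => f (p.1 * p.2)%g).
Proof. by move=> oU sf; have [_ h] := lie_mulP G; exact: (h U f oU sf). Qed.

Lemma ltrans_sheaf (U : set G) f (a : G) : open U -> lie_sheaf U f ->
  lie_sheaf [set y : G | U (a * y)%g] (fun y => f (a * y)%g).
Proof.
move=> oU sf.
have oW : open [set p : G * G | U (p.1 * p.2)%g].
  by apply: (open_comp (f := fun p : G * G => (p.1 * p.2)%g)) oU => y _; exact: lie_mul_continuous.
exact: (@sheaf_slice R G _ _ (lie_atlasP G) _ _ a oW (mul_sheaf oU sf)).
Qed.

(** In a chart around 1, join the points of a small ball to its centre by
    segments. *)
Lemma small_paths (U : set G) : nbhs (1%g : G) U ->
  exists2 W : set G, nbhs (1%g : G) W & forall x, W x ->
    exists2 g : R -> G, gpath g & [/\ g 0 = 1%g, g 1 = x & forall t, U (g t)].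
Proof.
move=> nU; have AP := lie_atlasP G.
have [c Ac d1] := chart_at AP (1%g : G).
have [od oi _ _ _] : is_chart c by have [+ _ _] := AP; apply.
pose p0 := c (1%g : G).
have nc : nbhs p0 ((c @` chart_dom c) `&` (chart_inv c @^-1` U)).
  apply: filterI; first by apply: open_nbhs_nbhs; split=> //; exists 1%g.
  by apply: (chart_inv_continuous AP Ac d1); rewrite (chart_invK AP Ac d1).
have [r /= r0 rU] := (nbhs_ballP _ _).1 nc.
exists (chart_dom c `&` c @^-1` (ball p0 r)).
  apply: filterI; first exact: near_open.
  by apply: (chart_continuous AP Ac d1); exact: nbhsx_ballx.
move=> x [dx bx]; pose q t := p0 + @clamp R t *: (c x - p0).
have bq t : ball p0 r (q t).
  rewrite -ball_normE /= /q opprD addrA subrr sub0r normrN normrZ.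
  move: bx; rewrite /= -ball_normE /= distrC; apply: le_lt_trans.
  rewrite -[leRHS]mul1r ler_wpM2r// ger0_norm.
    by rewrite ge_max ler01 ge_min lexx.
  by rewrite le_max lexx.
have e0 t : t <= 0 -> @clamp R t = 0.
  by move=> t0; rewrite /clamp min_r ?max_l// (le_trans t0).
have e1 t : 1 <= t -> @clamp R t = 1.
  by move=> t1; rewrite /clamp min_l// max_r.
exists (fun t => chart_inv c (q t)); last split.
- split=> [t|t t0|t t1]; last by rewrite /q (e1 t)// (e1 1).
    apply: (@continuous_comp _ _ _ q (chart_inv c)).
      apply: continuousD; first exact: cst_continuous.
      apply: continuousZr_tmp; exact: clamp_continuous.
    have [[y dy <-] _] := rU _ (bq t); exact: (chart_inv_continuous AP Ac dy).
  by rewrite /q (e0 t)// (e0 0).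
- by rewrite /q e0// scale0r addr0 (chart_invK AP Ac d1).
- by rewrite /q e1// scale1r subrKC (chart_invK AP Ac dx).
- by move=> t; have [_] := rU _ (bq t).
Qed.

End LieBasics.

Section Existence.
Variables (R : realType) (V : vectType R[i]) (G : lieGroup R).
Hypothesis G_sc : simply_connected R G.
Variable rho : G -> PGL V.
Hypothesis rho_hom : lie_hom (@lie_sheaf R G) (@pgl_sheaf R V) rho.
Local Notation n := (\dim {:V}).

Let mulC := @lie_mul_continuous R G.
Let invC := @lie_inv_continuous R G.
Let AP := lie_atlasP G.

Lemma group_hom1 (K H : groupType) (f : K -> H) : {morph f : x y / (x * y)%g} -> f 1%g = 1%g.
Proof.
move=> fM; have := fM 1%g 1%g; rewrite mulg1 => e.
by rewrite -[LHS](mulKg (f 1%g)) -e mulVg.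
Qed.

Section LocalLift.
Variable i0 : 'I_n.
Let C := pgl_cell i0.
Let phi (x : G) : GL V := pgl_section i0 (rho x).
Let D : set G := rho @^-1` C.

Let D_open : open D.
Proof. by apply: open_comp (pgl_cell_open i0) => x _; have [_ [+ _]] := rho_hom; apply. Qed.

Let rho1 : rho 1%g = 1%g. Proof. by have [/group_hom1] := rho_hom. Qed.

Let D1 : D 1%g. Proof. by rewrite /D /= rho1; exact: pgl_cell1. Qed.

Let phi1 : phi 1%g = 1%g. Proof. by rewrite /phi rho1 pgl_section1. Qed.

Let phi_smooth i j : cplx (@lie_sheaf R G D) (fun x => gl_mx (phi x) i j).
Proof.
have [_ [_ rs]] := rho_hom; have [s1 s2] := pgl_section_smooth i0 i j.
have oC := pgl_cell_open i0.
by split; [exact: (rs _ _ oC s1)|exact: (rs _ _ oC s2)].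
Qed.

(** The ratio of the corner entries of phi(x) phi(y) and phi(xy) is continuous at
    (1, 1), where it equals 1; hence the sum of its first n powers has positive real
    part nearby, and [pgl_section_mul] applies. *)
Lemma local_lift_mul : exists2 U : set G, nbhs 1%g U & U `<=` D /\
  forall x y, U x -> U y -> phi (x * y)%g = (phi x * phi y)%g.
Proof.
pose e : G * G := (1%g, 1%g).
pose P : set (G * G -> R^o) := fun f => {for e, continuous f}.
have PA : fun_algebra P by exact: continuous_algebra.
pose z (p : G * G) := gl_mx (phi p.1 * phi p.2)%g i0 i0 / gl_mx (phi (p.1 * p.2)%g) i0 i0.
have cphi i j : cplx (fun f : G -> R^o => {for (1%g : G), continuous f}) (fun x => gl_mx (phi x) i j).
  exact: (cplx_sheaf_continuous AP D_open (phi_smooth i j) D1).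
have cm : {for e, continuous (fun p : G * G => (p.1 * p.2)%g)} by exact: mulC.
have e1 : (e.1 * e.2 = 1 :> G)%g by rewrite mulg1.
have cphim i j : cplx P (fun p => gl_mx (phi (p.1 * p.2)%g) i j).
  by apply: (cplx_continuous_comp (g := fun x => gl_mx (phi x) i j) cm); rewrite e1.
have cz : cplx P z.
  apply: (cplxM PA).
    apply: (eq_cplx (g := fun p : G * G => \sum_k gl_mx (phi p.2) i0 k * gl_mx (phi p.1) k i0)).
      by move=> p; rewrite gl_mxM mxE.
    apply: (cplx_sum PA) => k _; apply: (cplxM PA).
      by apply: (cplx_continuous_comp (g := fun x => gl_mx (phi x) i0 k) (h := snd)) => //; exact: cvg_snd.
    by apply: (cplx_continuous_comp (g := fun x => gl_mx (phi x) k i0) (h := fst)) => //; exact: cvg_fst.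
  apply: (cplxV PA (D := [set e])) => //; first exact: continuous_inv_closed.
  by move=> _ ->; rewrite e1 phi1 gl_mx1 mxE eqxx oner_neq0.
have [cs _] : cplx P (fun p => \sum_(k < n) z p ^+ k).
  by apply: (cplx_sum PA) => k _; exact: (cplxX PA).
have ze : z e = 1 by rewrite /z e1 /= phi1 mulg1 gl_mx1 mxE eqxx divr1.
have spos : \forall p \near e, 0 < complex.Re (\sum_(k < n) z p ^+ k).
  apply: (cs [set r : R | 0 < r]); apply: open_nbhs_nbhs; split; first exact: open_gt.
  rewrite /= ze; under eq_bigr do rewrite expr1n.
  rewrite sumr_const card_ord.
  have -> : (1 *+ n : R[i]) = (n%:R : R)%:C%C by rewrite rmorph_nat.
  by rewrite /= ltr0n; exact: leq_ltn_trans (leq0n i0) (ltn_ord i0).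
have Dm : \forall p \near e, D (p.1 * p.2)%g.
  by apply: (cm D); rewrite /= e1; exact: near_open.
have [[A B] [/= nA nB] AB] := filterI spos Dm.
exists (A `&` B `&` D).
  by apply: filterI; [exact: filterI|exact: near_open].
split=> [x []//|x y [[Ax Bx] Dx] [[Ay By] Dy]].
have [zxy Dxy] := AB (x, y) (conj Ax By).
have [rM _] := rho_hom.
have := @pgl_section_mul R V i0 (rho x) (rho y) Dx Dy; rewrite -!rM.
by apply; [exact: Dxy|exact: zxy].
Qed.

(** The extension [f] of the local lift agrees with it near 1, hence is smooth near
    1, and everywhere because [f y = f x * f (x^-1 * y)]. It lifts rho since the two
    homomorphisms to PGL(V) agree near 1. *)
Lemma lift_exists_dim_pos : exists rhot : G -> GL V, is_lift rho rhot.
Proof.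
have [U nU [UD phiM]] := local_lift_mul.
have phiM' x y : U x -> U y -> U (x * y)%g -> phi (x * y)%g = (phi x * phi y)%g.
  by move=> Ux Uy _; exact: phiM.
have [f fM fphi] := extend_local_hom mulC invC nU phiM' G_sc.
have [U0 nU0 U0U] := close_near mulC invC nU (1%g : G).
have [W nW Wp] := small_paths nU0.
have fW x : W x -> f x = phi x.
  move=> /Wp[g pg [g0 g1 gU]]; rewrite -g1; apply: fphi => // s t.
  exact: U0U.
have [W' [oW' W'1] W'W] : exists2 W' : set G, open_nbhs 1%g W' & W' `<=` W `&` D.
  by have : nbhs (1%g : G) (W `&` D) by [apply: filterI => //; exact: near_open]; rewrite nbhsE.
have nW' : nbhs (1%g : G) W' by exact: near_open.
exists f; split; last first.
  have [rM _] := rho_hom.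
  have fpM : {morph (fun x => pgl_pi (f x)) : x y / (x * y)%g}.
    by move=> x y /=; rewrite fM pgl_piM.
  have fprho : (fun x => pgl_pi (f x)) = rho.
    apply: (homs_eq_near1 mulC invC nW' G_sc fpM rM).
    by move=> y /W'W[Wy Dy]; rewrite fW// pgl_sectionK.
  by move=> x; rewrite -fprho.
split=> //; apply: (smooth_into_GL AP) => i j; apply: cplx_sheaf_local => x _.
(* near x, f is phi composed with a translation and multiplied by a constant matrix *)
pose W'x : set G := [set y | W' (x^-1 * y)%g].
have oW'x : open W'x by exact: ltrans_open.
exists W'x; first by rewrite /W'x /= mulVg.
have PA := sheaf_algebra AP oW'x.
apply: (cplx_sheaf_congr AP (g := fun y =>
  \sum_k gl_mx (phi (x^-1 * y)%g) i k * gl_mx (f x) k j)) => //.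
  move=> y W'y; rewrite -[y in RHS](mulVKg x) fM (fW (x^-1 * y)%g); last by case: (W'W _ W'y).
  by rewrite gl_mxM mxE.
apply: (cplx_sum PA) => k _; apply: (cplxM PA); last exact: (cplx_cst PA).
have [s1 s2] := phi_smooth i k.
have s1' := ltrans_sheaf (x^-1)%g D_open s1; have s2' := ltrans_sheaf (x^-1)%g D_open s2.
by split; [apply: sheaf_sub s1'|apply: sheaf_sub s2'] => y /= /W'W[].
Qed.

End LocalLift.

(** It remains to treat V = 0, where GL(V) is trivial and no corner entry is
    available. *)
Theorem lift_exists : exists rhot : G -> GL V, is_lift rho rhot.
Proof.
have [n0|n0] := posnP n; last exact: (lift_exists_dim_pos (Ordinal n0)).
have GL1 (A C : GL V) : A = C.
  apply: gl_mx_inj; apply/matrixP => i; have := ltn_ord i; by rewrite [X in (_ < X)%N]n0.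
exists (fun=> 1%g); split; last by move=> x; rewrite -(pgl_reprK (rho x)); congr pgl_pi.
split; first by move=> x y; exact: GL1.
apply: (smooth_into_GL AP) => i; have := ltn_ord i; by rewrite [X in (_ < X)%N]n0.
Qed.

End Existence.

(** * Left-invariant vector fields *)

Section LeftFields.
Variables (R : realType) (G : lieGroup R).
Local Notation m := (lie_dim G).
Local Notation Coo := (@lie_sheaf R G setT).
Let AP := lie_atlasP G.

Variables (c1 : chart G 'rV[R]_m) (Ac1 : lie_atlas c1) (dc1 : chart_dom c1 1%g).
Local Notation p1 := (c1 1%g).

(** The left-invariant field with value [w] at 1, in the chart [c1]. *)
Definition left_field (w : 'rV[R]_m) (f : G -> R^o) : G -> R^o :=
  if `[< Coo f >] then (fun x => 'D_w (fun q => f (x * chart_inv c1 q)%g) p1) else 0.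

Lemma left_fieldE w f x : Coo f ->
  left_field w f x = 'D_w (fun q => f (x * chart_inv c1 q)%g) p1.
Proof. by move=> sf; rewrite /left_field; case: asboolP. Qed.

Lemma setT_ltrans (a : G) : [set y : G | [set: G] (a * y)%g] = setT.
Proof. by apply/seteqP; split. Qed.

Lemma Coo_ltrans a f : Coo f -> Coo (fun y => f (a * y)%g).
Proof. by move=> sf; have := ltrans_sheaf a openT sf; rewrite setT_ltrans. Qed.

Lemma chart_image_p1 : (c1 @` (chart_dom c1 `&` setT)) p1.
Proof. by exists 1%g. Qed.

Lemma left_field_derivable w f x : Coo f ->
  derivable (fun q => f (x * chart_inv c1 q)%g : R^o) p1 w.
Proof.
move=> sf; have [/= df _] := (Coo_ltrans x sf) c1 Ac1 1%N.
by apply: diff_derivable; apply: df; exact: chart_image_p1.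
Qed.

(** In charts, [left_field w f] is a partial derivative of the smooth function
    f(x y) of two variables, restricted to y = 1. *)
Lemma left_field_smooth w f : Coo f -> Coo (left_field w f).
Proof.
move=> sf; have -> : left_field w f = fun x => 'D_w (fun q => f (x * chart_inv c1 q)%g) p1.
  by apply/funext => x; exact: left_fieldE.
move=> c Ac; rewrite setIT.
pose F := (fun p : G * G => f (p.1 * p.2)%g : R^o) \o chart_inv (prod_chart c c1).
have sF := mul_sheaf openT sf (ex_intro _ c (ex_intro _ c1 (And3 Ac Ac1 erefl))).
have sDF : smooth_on ((prod_chart c c1 : _ -> 'rV[R]_m * 'rV[R]_m)
   @` (chart_dom (prod_chart c c1) `&` [set p : G * G | [set: G] (p.1 * p.2)%g])) ('D_(0, w) F).
  by move=> k; have [_ DF] := sF k.+1; exact: DF.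
have -> : (fun x : G => 'D_w (fun q => f (x * chart_inv c1 q)%g) p1) \o chart_inv c =
    'D_(0, w) F \o (fun p => (p, p1)).
  by apply/funext => p; exact: esym (derive_slice F p p1 w).
have := chart_image_open AP Ac openT; rewrite setIT => oc.
apply: (@smooth_on_comp R _ ('rV[R]_m * 'rV[R]_m)%type _ (@pair_frame R m m) _ _
  (fun k q => pair_coord (q, p1) k) (fun q => (q, p1)) _ _ _ _ _ sDF) => //.
- by move=> q _; exact: pair_frameE.
- by move=> q /= [x dx <-]; exists (x, 1%g).
- by move=> [j|j]; [exact: smooth_row_coord|move=> k; exact: Ck_on_cst].
Qed.

Lemma left_field_lie w : lie_algebra (left_field w).
Proof.
have [PC PD PM] := sheaf_algebra AP (@openT G).
have PZ (a : R) f : Coo f -> Coo (a *: f) by move=> sf; exact: (PM _ _ (PC a) sf).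
split.
- split; first exact: left_field_smooth.
  by move=> f nf; rewrite /left_field asboolF.
- move=> a f g sf sg; apply/funext => x.
  have sfg : Coo (a *: f + g) by exact: (PD _ _ (PZ a _ sf) sg).
  rewrite left_fieldE//= [RHS]/(a * left_field w f x + left_field w g x) !left_fieldE//.
  have dZ := derivableZ (k := a) (@left_field_derivable w f x sf).
  have := deriveD dZ (@left_field_derivable w g x sg).
  by rewrite deriveZ//; exact: left_field_derivable.
- move=> f g sf sg; apply/funext => x.
  have sfg : Coo (f \* g) by exact: (PM _ _ sf sg).
  rewrite left_fieldE//= [RHS]/(left_field w f x * g x + f x * left_field w g x) !left_fieldE//.
  have := deriveM (@left_field_derivable w f x sf) (@left_field_derivable w g x sg).
  rewrite /= !(chart_invK AP Ac1 dc1) !mulg1 => ->.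
  by rewrite addrC; congr (_ + _); rewrite [LHS]mulrC.
- move=> x f sf; apply/funext => y.
  rewrite !left_fieldE//; last exact: Coo_ltrans.
  by congr ('D_w _ p1); apply/funext => q; rewrite mulgA.
Qed.

End LeftFields.

(** * Uniqueness of the lift *)

Section KilledFunctions.
Variables (R : realType) (G : lieGroup R).
Local Notation m := (lie_dim G).
Local Notation Coo := (@lie_sheaf R G setT).
Let AP := lie_atlasP G.

(** This is the smoothness of the transition maps. *)
Lemma chart_coord_sheaf c j : lie_atlas c -> lie_sheaf (chart_dom c) (fun x : G => c x ord0 j : R^o).
Proof.
move=> Ac c' Ac' k; have [_ _ /(_ c' c Ac' Ac) st] := AP.
have [od _ _ _ _] : is_chart c by have [+ _ _] := AP; apply.
exact: (Ck_on_coord j (chart_image_open AP Ac' od) (st k)).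
Qed.

(** At the unit, the values of left-invariant fields exhaust the tangent space, so
    every left translate of [f], being killed as well, has zero differential at 1.
    Translating back, [f] has zero differential everywhere. *)
Lemma killed_locally_constant (f : G -> R^o) : Coo f -> (forall D, lie_algebra D -> D f = 0) ->
  \forall x \near (1%g : G), f x = f 1%g.
Proof.
move=> sf kf; have [c Ac d1] := chart_at AP (1%g : G).
have [od oi _ _ _] : is_chart c by have [+ _ _] := AP; apply.
pose p1 := c (1%g : G).
have [r /= r0 rc] : exists2 r : R, 0 < r & ball p1 r `<=` c @` chart_dom c.
  by apply/nbhs_ballP; apply: open_nbhs_nbhs; split=> //; exists 1%g.
pose g := f \o chart_inv c.
have sg : smooth_on (c @` (chart_dom c `&` setT)) g by exact: sf.
suff key q : ball p1 r q -> differentiable g q /\ forall w, 'D_w g q = 0.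
  have nx : \forall x \near (1%g : G), chart_dom c x /\ ball p1 r (c x).
    apply: filterI; first exact: near_open.
    by apply: (chart_continuous AP Ac d1); exact: nbhsx_ballx.
  apply: filterS nx => x [dx bx].
  by have := zero_diff_constant key bx; rewrite /g /= !(chart_invK AP Ac).
move=> bq; have [y dy yq] := rc _ bq.
have dg : differentiable g q.
  by have [dg _] := sg 1%N; apply: dg; exists y.
split=> // w.
pose gy q' : R^o := f (y * chart_inv c q')%g.
have dgy : differentiable gy p1.
  by have [h _] := Coo_ltrans y sf Ac 1%N; apply: h; exists 1%g.
(* the derivative of gy at p1 is the value at y of a left-invariant derivation of f *)
have dgy0 w' : 'd gy p1 w' = 0.
  rewrite -(deriveE _ dgy) -(left_fieldE c w' y sf).
  by rewrite kf//; exact: left_field_lie.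
pose O := c @` (chart_dom c `&` [set z | chart_dom c (y^-1 * z)%g]).
have oT : open [set z : G | chart_dom c (y^-1 * z)%g] by exact: ltrans_open.
have oO : open O by exact: (chart_image_open AP Ac oT).
have Oq : O q by exists y => //; split=> //=; rewrite mulVg.
(* in the chart, [th] is translation by y^-1; it takes q to p1 and g = gy o th near q *)
pose th q' := c (y^-1 * chart_inv c q')%g.
have dth : differentiable th q.
  have -> : th = \sum_j (fun q' => th q' ord0 j *: delta_mx ord0 j).
    by apply/funext => q'; rewrite fct_sumE; exact: row_sum_delta.
  elim/big_ind : _ => [|? ? ? ?|j _]; first exact: differentiable_cst.
    exact: differentiableD.
  have := ltrans_sheaf (y^-1)%g od (chart_coord_sheaf j Ac) => /(_ c Ac 1%N)[h _].
  exact: (differentiableZl (delta_mx ord0 j) (h q Oq)).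
have thq : th q = p1 by rewrite /th -yq (chart_invK AP Ac dy) mulVg.
have ggy : \near q, gy (th q) = g q.
  apply: filterS (near_open oO Oq) => q' [z [dz dyz] <-].
  by rewrite /gy /th /g /= (chart_invK AP Ac dz) (chart_invK AP Ac dyz) mulVKg.
rewrite -(near_eq_derive w ggy).
have dgy' : differentiable gy (th q) by rewrite thq.
rewrite (deriveE _ (differentiable_comp dth dgy')) (diff_comp dth dgy') /=.
by rewrite thq dgy0.
Qed.

End KilledFunctions.

Section Uniqueness.
Variables (R : realType) (G : lieGroup R).
Local Notation Coo := (@lie_sheaf R G setT).
Let AP := lie_atlasP G.

Section Character.
Variable chi : G -> R[i].
Hypothesis chiM : forall x y, chi (x * y)%g = chi x * chi y.
Hypothesis chi1 : chi 1%g = 1.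
Hypothesis chi_smooth : cplx Coo chi.

Let u : G -> R^o := fun x => complex.Re (chi x).
Let v : G -> R^o := fun x => complex.Im (chi x).

Let su : Coo u. Proof. by have [] := chi_smooth. Qed.
Let sv : Coo v. Proof. by have [] := chi_smooth. Qed.

Let u1 : u 1%g = 1. Proof. by rewrite /u chi1. Qed.
Let v1 : v 1%g = 0. Proof. by rewrite /v chi1. Qed.

Let PZ (a : R) f : Coo f -> Coo (a *: f).
Proof. by have [PC _ PM] := sheaf_algebra AP (@openT G); move=> sf; exact: (PM _ _ (PC a) sf). Qed.

Lemma lie_algebra_comb D (a b : R) f g : lie_algebra D -> Coo f -> Coo g ->
  D (a *: f + b *: g) = a *: D f + b *: D g.
Proof.
move=> [_ lin _ _] sf sg; have [PC _ _] := sheaf_algebra AP (@openT G).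
have s0 : Coo 0 by exact: PC.
have D0 : D 0 = 0.
  have := lin 1 0 0 s0 s0; rewrite !scale1r addr0 => e.
  by apply: (addrI (D 0)); rewrite -e addr0.
rewrite lin//; last exact: PZ.
by congr (_ + _); have := lin b g 0 sg s0; rewrite addr0 D0 addr0.
Qed.

(** Differentiate chi(x y) = chi(x) chi(y) in y at y = 1. *)
Lemma field_on_character D : lie_algebra D ->
  D u = D u 1%g *: u + (- D v 1%g) *: v /\ D v = D v 1%g *: u + D u 1%g *: v.
Proof.
move=> LD; have [_ _ _ inv] := LD; split; apply/funext => x.
  have := inv x u su.
  have -> : (fun y => u (x * y)%g) = u x *: u + (- v x) *: v.
    apply/funext => y; rewrite /u /v chiM !fctE.
    by case: (chi x) (chi y) => ? ? [? ?] /=; rewrite /GRing.scale /= mulNr.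
  rewrite lie_algebra_comb// => /(congr1 (fun h => h 1%g)); rewrite mulg1 => <-.
  rewrite !fctE /= /GRing.scale /=; ring.
have := inv x v sv.
have -> : (fun y => v (x * y)%g) = v x *: u + u x *: v.
  apply/funext => y; rewrite /u /v chiM !fctE; case: (chi x) (chi y) => ? ? [? ?] /=.
  by rewrite addrC.
rewrite lie_algebra_comb// => /(congr1 (fun h => h 1%g)); rewrite mulg1 => <-.
rewrite !fctE /= /GRing.scale /=; ring.
Qed.

(** By [field_on_character] both fields act on the span of u and v as
    multiplication by complex numbers, and these commute. *)
Lemma bracket_kills_character D1 D2 : lie_algebra D1 -> lie_algebra D2 ->
  op_bracket D1 D2 u = 0 /\ op_bracket D1 D2 v = 0.
Proof.
move=> L1 L2; have [] := field_on_character L1; have [] := field_on_character L2.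
move: (D1 u 1%g) (D1 v 1%g) (D2 u 1%g) (D2 v 1%g) => a1 b1 a2 b2 eu2 ev2 eu1 ev1.
have e1 : D1 (D2 u) = a2 *: D1 u + (- b2) *: D1 v by rewrite eu2 lie_algebra_comb.
have e2 : D2 (D1 u) = a1 *: D2 u + (- b1) *: D2 v by rewrite eu1 lie_algebra_comb.
have e3 : D1 (D2 v) = b2 *: D1 u + a2 *: D1 v by rewrite ev2 lie_algebra_comb.
have e4 : D2 (D1 v) = b1 *: D2 u + a1 *: D2 v by rewrite ev1 lie_algebra_comb.
split; apply/funext => x.
  rewrite -[LHS]/(D1 (D2 u) x - D2 (D1 u) x) -[RHS]/(0 : R) e1 e2 eu1 eu2 ev1 ev2.
  by rewrite !fctE /= /GRing.scale /=; ring.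
rewrite -[LHS]/(D1 (D2 v) x - D2 (D1 v) x) -[RHS]/(0 : R) e3 e4 eu1 eu2 ev1 ev2.
by rewrite !fctE /= /GRing.scale /=; ring.
Qed.

Hypothesis ss : semisimple_group G.

(** In a simple factor, the fields killing u and v form an ideal that contains all
    brackets, among which one is nonzero; so it is the whole factor. *)
Lemma semisimple_kills_character D : lie_algebra D -> D u = 0 /\ D v = 0.
Proof.
have [k [S [SL Ssum _]]] := ss.
have Sk i D' : S i D' -> D' u = 0 /\ D' v = 0.
  have [[SiL [Si0 SiZ] Sibr] [[x [y [Sx Sy xy0]]] simp]] := SL i.
  pose I : set ((G -> R^o) -> (G -> R^o)) := [set D | S i D /\ (D u = 0 /\ D v = 0)].
  have brI x' y' : S i x' -> S i y' -> I (op_bracket x' y').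
    move=> Sx' Sy'; split; first exact: (Sibr _ _ (SiL _ Sx') Sy').
    by apply: bracket_kills_character; exact: SiL.
  have [|I0|IS] := simp I; last by rewrite -IS => -[_].
    split; [by move=> ? []|split|].
    - by split=> //; split.
    - move=> a f g [Sf [fu fv]] [Sg [gu gv]]; split; first exact: SiZ.
      split; first by rewrite -[LHS]/(a *: f u + g u) fu gu scaler0 addr0.
      by rewrite -[LHS]/(a *: f v + g v) fv gv scaler0 addr0.
    - by move=> x' y' Sx' [Sy' _]; exact: brI.
  have := brI x y Sx Sy; rewrite I0 => /= e.
  by move: xy0; rewrite e eqxx.
move=> LD; have [y Sy ->] := Ssum D LD.
by split; rewrite fct_sumE big1// => i _; have [] := Sk i (y i) (Sy i).
Qed.

Lemma semisimple_character_trivial : \forall x \near (1%g : G), chi x = 1.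
Proof.
have nu := killed_locally_constant su (fun D LD => (semisimple_kills_character LD).1).
have nv := killed_locally_constant sv (fun D LD => (semisimple_kills_character LD).2).
apply: filterS (filterI nu nv) => x []; rewrite u1 v1 /u /v.
by case: (chi x) => a b /= -> ->.
Qed.

End Character.

Variable V : vectType R[i].
Local Notation n := (\dim {:V}).

(** The matrix entries are smooth functions on GL(V). *)
Lemma smooth_from_GL (h : G -> GL V) i j :
  smooth_map (@lie_sheaf R G) (@gl_sheaf R V) h -> cplx Coo (fun x => gl_mx (h x) i j).
Proof.
move=> [_ sh]; have oi := @gl_image_open R V setT openT.
have [s1 s2] : cplx (smooth_on (@gl_coord R V @` setT)) (fun z => gl_mx (gl_of_coord z) i j).
  apply: cplx_smooth_congr (cplx_smooth_model_mx i j oi) => // z [A _ <-].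
  by rewrite model_mx_coord gl_of_coordK.
split.
  by apply: (sh setT (fun A => complex.Re (gl_mx A i j)) openT); exact/gl_sheafE.
by apply: (sh setT (fun A => complex.Im (gl_mx A i j)) openT); exact/gl_sheafE.
Qed.

Lemma gl_mx_entry (i0 : 'I_n) (A : GL V) : exists i j, gl_mx A i j != 0.
Proof.
apply/not_existsP => h.
have A0 : gl_mx A = 0.
  apply/matrixP => i j; rewrite [RHS]mxE; apply/eqP; apply: contrapT => /negP Aij.
  by apply: (h i); exists j.
have := congr1 (fun M : 'M[R[i]]_n => M i0 i0) (gl_mxM A (A^-1)%g).
rewrite mulgV gl_mx1 A0 mulmx0 !mxE eqxx => /eqP.
by rewrite oner_eq0.
Qed.

(** Two lifts differ by a character chi of G with values in the nonzero complex
    numbers. It is smooth, being locally a quotient of matrix entries, hence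
    trivial near 1; so the lifts agree near 1, hence everywhere. *)
Theorem lift_unique_semisimple (G_sc : simply_connected R G) (rho : G -> PGL V)
    (rho1 rho2 : G -> GL V) :
  semisimple_group G -> is_lift rho rho1 -> is_lift rho rho2 -> rho1 = rho2.
Proof.
move=> ss [[M1 S1] p1] [[M2 S2] p2].
have [n0|n0] := posnP n.
  apply/funext => x; apply: gl_mx_inj; apply/matrixP => i; have := ltn_ord i.
  by rewrite [X in (_ < X)%N]n0.
pose i0 := Ordinal n0.
have chi_ex x : exists a, gl_mx (rho1 x) = a *: gl_mx (rho2 x).
  have /pgl_pi_mx[a _ e] : pgl_pi (rho1 x) = pgl_pi (rho2 x) by rewrite p1 p2.
  by exists a.
have [chi chiE] := choice chi_ex.
have scale_inj a b (A : GL V) : a *: gl_mx A = b *: gl_mx A -> a = b.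
  have [i [j Aij]] := gl_mx_entry i0 A.
  move=> /(congr1 (fun M : 'M[R[i]]_n => M i j)); rewrite [LHS]mxE [RHS]mxE.
  exact: mulIf.
have chiM x y : chi (x * y)%g = chi x * chi y.
  apply: (scale_inj _ _ (rho2 (x * y)%g)); rewrite -chiE M1 M2 !gl_mxM !chiE.
  by rewrite -scalemxAl -scalemxAr scalerA mulrC.
have chi1 : chi 1%g = 1.
  apply: (scale_inj _ _ (rho2 1%g)); rewrite -chiE scale1r.
  by rewrite (group_hom1 M1) (group_hom1 M2).
have chi_smooth : cplx Coo chi.
  apply: cplx_sheaf_local => x _; have [i [j xij]] := gl_mx_entry i0 (rho2 x).
  have s1 := smooth_from_GL i j S1; have s2 := smooth_from_GL i j S2.
  pose W := [set y : G | [set: G] y /\ gl_mx (rho2 y) i j != 0].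
  have oW : open W.
    apply: cplx_open_neq0; first exact: openT.
    by move=> y _; exact: (cplx_sheaf_continuous AP openT s2).
  exists W => //; have PA := sheaf_algebra AP oW.
  apply: (cplx_sheaf_congr AP (g := fun y => gl_mx (rho1 y) i j * (gl_mx (rho2 y) i j)^-1)) => //.
    by move=> y [_ yij]; rewrite chiE [in LHS]mxE mulfK.
  have [s11 s12] := s1; have [s21 s22] := s2.
  have WT : W `<=` [set: G] by [].
  apply: (cplxM PA); first by split; [exact: sheaf_sub WT s11|exact: sheaf_sub WT s12].
  apply: (cplxV PA (D := W)); first exact: sheaf_inv_closed.
    by split; [exact: sheaf_sub WT s21|exact: sheaf_sub WT s22].
  by move=> y [].
have nchi := semisimple_character_trivial chiM chi1 chi_smooth ss.
apply: (homs_eq_near1 (@lie_mul_continuous R G) (@lie_inv_continuous R G) nchi G_sc M1 M2).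
by move=> x cx; apply: gl_mx_inj; rewrite chiE cx scale1r.
Qed.

End Uniqueness.

Theorem theorem1p1p8 (R : realType) (V : vectType R[i]) (G : lieGroup R)
    (G_sc : simply_connected R G)
    (rho : G -> PGL V)
    (rho_hom : lie_hom (@lie_sheaf R G) (@pgl_sheaf R V) rho) :
  (exists rhot : G -> GL V, is_lift rho rhot) /\
  (semisimple_group G ->
   forall rho1 rho2 : G -> GL V, is_lift rho rho1 -> is_lift rho rho2 ->
   rho1 = rho2).
Proof.
split; first exact: lift_exists.
by move=> ss rho1 rho2; exact: lift_unique_semisimple.
Qed.
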